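(* Let $T=(T_i)_{i\ge1}$ be a sequence of nonnegative random variables satisfying assumptions (i)--(vi) listed in the context, with the corresponding $\alpha\in(0,1]$ and $r>1$. Let $X\ge0$ be a (not identically zero) solution of the fixed point equation $X\stackrel{\mathcal{D}}{=}\sum_{i\ge1}X_iT_i$, let $F$ be its distribution function and $\overline F(x)=\mathbf{P}\{X>x\}$, and let $h$ and $\ell$ be the functions associated to $X$ as in the context. If $\alpha<1$, then $$\lim_{n\to\infty}\frac{(r^nz)^\alpha}{\ell(r^{\alpha n})}\,\mathbf{P}\{X>r^nz\}=p(z)\quad\text{for each } z\in C_p,$$ where $p=\mathrm{B}_{1-\alpha}^{-1}\mathrm{A}_{1-\alpha}^{-1}h$. If $\alpha=1$, then $h(t)\equiv h$ is necessarily a constant, and $$\int_0^xy\,\mathrm{d}F(y)\sim h\,\ell(x)\quad\text{as } x\to\infty.$$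
   Context: Fixed point equation: $X\stackrel{\mathcal{D}}{=}\sum_{i\ge1}X_iT_i$, where $X_1,X_2,\ldots$ are iid copies of $X$, independent of $T$ (the $T_i$ may be dependent, finitely or infinitely many nonzero). Let $N=\sum_iI(T_i>0)$ be the number of positive terms and $m(\theta)=\mathbf{E}\sum_{i=1}^NT_i^\theta$, the sum being over the positive terms. Assumptions: (i) $\mathbf{P}\{T\in\{0,1\}^{\mathbb{N}}\}<1$; (ii) $\mathbf{E}N>1$; (iii) there exists $\alpha\in(0,1]$ such that $1=m(\alpha)<m(\beta)$ for each $\beta\in[0,\alpha)$; (iv) either $\mathbf{E}\sum_{i\ge1}T_i^\alpha\log T_i\in(-\infty,0)$ and $\mathbf{E}\big(\sum_{i\ge1}T_i^\alpha\big)\log_+\sum_{i\ge1}T_i^\alpha<\infty$, or there is a $\theta\in[0,\alpha)$ such that $m(\theta)<\infty$; (v) there exists a nonnegative random variable $W$, not identically $0$, such that $W\stackrel{\mathcal{D}}{=}\sum_{i\ge1}T_i^\alpha W_i$, where $W_1,W_2,\ldots$ are iid copies of $W$, independent of $T$; (vi) the positive elements of $T$ are concentrated on $r^{\mathbb{Z}}=\{r^k:k\in\mathbb{Z}\}$ for some $r>1$, and $r^{\mathbb{Z}}$ is the smallest such group (i.e. $r$ is the largest such number). Known fact (Alsmeyer, Biggins and Meiners), used to define $h$ and $\ell$: under (i)--(vi) the Laplace transform $\varphi(t)=\mathbf{E}e^{-tX}$ of the solution has the form $\varphi(t)=\psi(h(t)t^\alpha)$, $t\ge0$, where $h$ is a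 positive function with $h(rt)=h(t)$ for all $t>0$ such that $h(t)t^\alpha$ is a Bernstein function (its derivative is completely monotone), and $\psi$ is the Laplace transform of the random variable $W$ in (v), such that $(1-\psi(t))/t$ is slowly varying at $0$. Fix such $h,\psi$ and let $\ell$ be the function slowly varying at infinity given by $1-\psi(t)=t\,\ell(1/t)$. A function $\ell:(0,\infty)\to(0,\infty)$ is slowly varying at infinity (at $0$) if it is measurable and $\ell(\lambda x)/\ell(x)\to1$ as $x\to\infty$ (as $x\downarrow0$) for every $\lambda>0$. $\mathcal{P}_r$ is the set of functions $p:(0,\infty)\to(0,\infty)$ that are bounded, right-continuous, satisfy $\inf_{x\in[1,r]}p(x)>0$, and $p(xr)=p(x)$ for all $x>0$. $C_p$ is the set of continuity points of $p$. For $\rho>0$, $\mathcal{P}_{r,\rho}$ is the set of $p\in\mathcal{P}_r$ such that $x^\rho p(x)$ is nondecreasing, and $\mathcal{Q}_{r,\rho}$ is the set of $q:(0,\infty)\to(0,\infty)$ such that $s^{-\rho}q(s)$ is completely monotone and $q(sr)=q(s)$ for all $s>0$. For $\rho>0$, $\mathrm{A}_\rho:\mathcal{P}_{r,\rho}\to\mathcal{Q}_{r,\rho}$, $\mathrm{A}_\rho p(s)=s^\rho\int_0^\infty e^{-sx}\,\mathrm{d}(p(x)x^\rho)$, is a bijection with inverse $\mathrm{A}_\rho^{-1}$. For $\rho>0$ and $p\in\mathcal{P}_r$, $\mathrm{B}_\rho p(x)=x^{-\rho}\int_0^xy^{\rho-1}p(y)\,\mathrm{d}y$; it is injective on $\mathcal{P}_r$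 and $\mathrm{B}_\rho^{-1}q$ denotes the unique element of $\mathcal{P}_r$ mapped to $q$. The formula for $p$ includes the assertion that the inverses are applied to elements in the ranges. $f\sim g$ means $f/g\to1$. *)

(* Defs.v *)
From HB Require Import structures.
From mathcomp Require Import all_boot all_order all_algebra.
From mathcomp Require Import all_classical all_reals all_analysis.
From mathcomp Require Import measurable_realfun.

Set Implicit Arguments.
Unset Strict Implicit.
Unset Printing Implicit Defensive.
Import Order.TTheory GRing.Theory Num.Theory.
Import numFieldNormedType.Exports.
Local Open Scope classical_set_scope.
Local Open Scope ring_scope.

Section weights.
Context d (Omega : measurableType d) (R : realType) (P : probability Omega R).
Variable T : nat -> Omega -> R.

Definition positive_count (w : Omega) : \bar R :=
  (\sum_(0 <= i <oo) (\1_[set w' | (0 < T i w')%R] w)%:E)%E.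

(* Only the positive terms are summed; this matters because 0 `^ 0 = 1. *)
Definition moment (theta : R) : \bar R :=
  (\int[P]_w \sum_(0 <= i <oo | (0 < T i w)%R) (T i w `^ theta)%:E)%E.

Definition rpowers (r : R) : set R := range (fun k : int => r ^ k).

Definition concentrated_on (A : set R) : Prop :=
  {ae P, forall w, forall i, 0 < T i w -> A (T i w)}.

End weights.

Definition log_plus (R : realType) (y : \bar R) : \bar R := maxe 0%E (lne y).

Definition product_sigma (R : realType) : set_system (nat -> R) :=
  <<s [set E | exists i (A : set R), measurable A /\ E = [set u | A (u i)]] >>.

Definition same_law_seq (R : realType)
    d (Omega : measurableType d) (P : probability Omega R)
    d' (Omega' : measurableType d') (P' : probability Omega' R)
    (T : nat -> Omega -> R) (T' : nat -> Omega' -> R) : Prop :=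
  forall E : set (nat -> R), product_sigma E ->
    P [set w | E (fun i => T i w)] = P' [set w | E (fun i => T' i w)].

(* Y_0, Y_1, ... are mutually independent and jointly independent of the whole
   sequence T, whose entries may depend on each other. *)
Definition independent_of_seq (R : realType)
    d (Omega : measurableType d) (P : probability Omega R)
    (T Y : nat -> Omega -> R) : Prop :=
  forall (E : set (nat -> R)) (n : nat) (B : 'I_n -> set R),
    product_sigma E -> (forall i, measurable (B i)) ->
    P [set w | E (fun i => T i w) /\ forall i : 'I_n, B i (Y i w)] =
    (P [set w | E (fun i => T i w)] * \prod_(i < n) P (Y i @^-1` B i))%E.

(* The equation only involves the law of the sequence T and the law of X: the
   copies Y of X, independent of T, live together with a copy T' of T on some
   probability space. The series is taken in \bar R, so that equality in
   distribution includes its almost sure finiteness. *)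
Definition fixed_point_equation (R : realType)
    d (Omega : measurableType d) (P : probability Omega R)
    (T : nat -> Omega -> R)
    d0 (Omega0 : measurableType d0) (P0 : probability Omega0 R)
    (X : {RV P0 >-> R}) : Prop :=
  exists d' (Omega' : measurableType d') (P' : probability Omega' R)
         (T' Y : nat -> {RV P' >-> R}),
    [/\ same_law_seq P P' T T',
        forall i (A : set R), measurable A ->
          distribution P' (Y i) A = distribution P0 X A,
        independent_of_seq P' T' Y
      & forall A : set (\bar R), measurable A ->
          P0 [set w | A (X w)%:E] =
          P' [set w | A (\sum_(0 <= i <oo) (Y i w * T' i w)%:E)%E]].

Definition laplace (R : realType)
    d (Omega : measurableType d) (P : probability Omega R)
    (X : {RV P >-> R}) (t : R) : R :=
  \int[P]_w expR (- (t * X w)).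

Section functions.
Context (R : realType).
Implicit Types (f g h p q l : R -> R) (r rho : R).

(* Functions on (0, oo) are represented by total functions whose values outside
   (0, oo) are irrelevant. *)

Definition slowly_varying (F : set_system R) l : Prop :=
  [/\ measurable_fun (`]0, +oo[ : set R) l,
      forall x, 0 < x -> 0 < l x
    & forall lambda, 0 < lambda -> l (lambda * x) / l x @[x --> F] --> (1 : R)].

Definition completely_monotone f : Prop :=
  forall (n : nat) x, 0 < x ->
    derivable (f^`(n))%classic x 1 /\ 0 <= (-1) ^+ n * (f^`(n))%classic x.

Definition bernstein f : Prop :=
  [/\ forall x, 0 < x -> 0 <= f x,
      forall x, 0 < x -> derivable f x 1
    & completely_monotone (f^`())%classic].

Definition calP r p : Prop :=
  [/\ forall x, 0 < x -> 0 < p x,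
      exists M, forall x, 0 < x -> p x <= M,
      forall x, 0 < x -> p y @[y --> x^'+] --> p x,
      0 < inf [set p x | x in `[1, r]]
    & forall x, 0 < x -> p (x * r) = p x].

Definition calP_rho r rho p : Prop :=
  [/\ 0 < rho, calP r p
    & forall x y, 0 < x -> x <= y -> x `^ rho * p x <= y `^ rho * p y].

Definition calQ_rho r rho q : Prop :=
  [/\ 0 < rho,
      forall s, 0 < s -> 0 < q s,
      completely_monotone (fun s => s `^ (- rho) * q s)
    & forall s, 0 < s -> q (s * r) = q s].

(* The function p(x) x^rho, extended by its limit 0 at 0 to the negative
   half-line in order to be the integrator of a Stieltjes measure on R. *)
Definition integrator r rho p (_ : calP_rho r rho p) (x : R) : R :=
  if 0 < x then p x * x `^ rho else 0.

Section integrator_cumulative.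
Context r rho p (hp : calP_rho r rho p).

Lemma integrator_nd : nondecreasing (integrator hp).
Proof.
have [_ [p0 _ _ _ _] nd] := hp; move=> x y xy; rewrite /integrator.
case: ifPn => x0; last first.
  by case: ifPn => // y0; rewrite mulr_ge0 ?powR_ge0// ltW// p0.
by rewrite (lt_le_trans x0 xy) mulrC [leRHS]mulrC; exact: nd.
Qed.

Lemma integrator_rc : right_continuous (integrator hp).
Proof.
have [rho0 [p0 [M pM] rc _ _] _] := hp; move=> x.
have [x0|x0|x0] := ltgtP x 0.
- rewrite {2}/integrator ltNge (ltW x0)/=.
  apply: cvg_within_filter; apply: cvg_near_cst.
  near=> y; rewrite /integrator ifF//; apply/negbTE; rewrite -leNgt ltW//.
  by near: y; exact: lt_nbhsl.
- rewrite {2}/integrator x0.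
  have H : (p y * y `^ rho) @[y --> x^'+] --> p x * x `^ rho.
    apply: cvgM; first exact: rc.
    apply: cvg_within_filter.
    have /derivable1_diffP/differentiable_continuous :
        derivable (@powR R ^~ rho) x 1.
      by apply: derivable_powR; rewrite in_itv/= x0.
    exact.
  apply: cvg_trans H; apply: near_eq_cvg.
  near=> y; rewrite /integrator ifT//.
  rewrite (lt_trans x0)//; near: y; exact: nbhs_right_gt.
- subst x; rewrite {2}/integrator ltxx.
  apply: (@squeeze_cvgr _ _ _ _ (fun=> 0) (fun y => M * y `^ rho)).
  + near=> y.
    have y0 : 0 < y by near: y; exact: nbhs_right_gt.
    rewrite /integrator y0 mulr_ge0 ?powR_ge0 ?ler_wpM2r ?powR_ge0 ?pM//.
    by rewrite ltW// p0.
  + exact: cvg_cst.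
  + rewrite -[X in _ --> X](mulr0 M); apply: cvgM; first exact: cvg_cst.
    exact: powR_cvg0.
Unshelve. all: by end_near. Qed.

HB.instance Definition _ :=
  isCumulative.Build R _ R (integrator hp) integrator_nd integrator_rc.

Definition opA (s : R) : R :=
  s `^ rho *
  \int[lebesgue_stieltjes_measure (integrator hp)]_(x in `]0, +oo[)
    expR (- (s * x)).

End integrator_cumulative.

Definition opB rho p (x : R) : R :=
  x `^ (- rho) *
  \int[@lebesgue_measure R]_(y in `]0, x]) (y `^ (rho - 1) * p y).

(* p = A_rho^-1 q, including that q belongs to the range of A_rho. *)
Definition is_opA_inv r rho q p : Prop :=
  calQ_rho r rho q /\
  exists hp : calP_rho r rho p, forall s, 0 < s -> opA hp s = q s.

(* p = B_rho^-1 q, including that q belongs to the range of B_rho. *)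
Definition is_opB_inv r rho q p : Prop :=
  [/\ 0 < rho, calP r p & forall x, 0 < x -> opB rho p x = q x].

End functions.

(* Main.v *)
Require Import Defs.
From HB Require Import structures.
From mathcomp Require Import all_boot all_order all_algebra.
From mathcomp Require Import all_classical all_reals all_analysis.
From mathcomp Require Import measurable_realfun.
From mathcomp Require Import ring lra.

Set Implicit Arguments.
Unset Strict Implicit.
Unset Printing Implicit Defensive.
Import Order.TTheory GRing.Theory Num.Theory.
Import numFieldNormedType.Exports.
Local Open Scope classical_set_scope.
Local Open Scope ring_scope.

(** The solution X is rescaled to Z_n = X / r^n and its tail is multiplied by
    c_n = r^(alpha n) / l(r^(alpha n)). Slow variation of l and the periodicity
    of h give c_n E[1 - exp(- s Z_n)] --> h(s) s^alpha for every s > 0.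

    Let U_n(x) = c_n E[min(Z_n, x)] be the integrated rescaled tail. Weierstrass
    approximation of min(- ln y, x) / (1 - y) by polynomials in y = exp(- Z_n)
    turns the convergence of the Laplace transforms into that of U_n(x). The
    limit U is concave, satisfies U(r x) = r^(1 - alpha) U(x), and
    s^2 int_0^oo exp(- s y) U(y) dy = h(s) s^alpha. For alpha < 1, U is thus
    x^(1 - alpha) q(x) with q = A^-1 h, and its right derivative is
    x^(- alpha) p(x) with p = B^-1 q. Any other pair (q, p) yields the same U by
    injectivity of the Laplace transform. As the rescaled tail c_n P(Z_n > x) is
    squeezed between the difference quotients of the concave U_n, it converges
    wherever U is differentiable.

    For alpha = 1, h(t) = (h(t) t) / t is completely monotone, hence
    nonincreasing, hence constant by periodicity. With v = X / x, the truncated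
    moment E[X; X <= x] is compared pointwise with A(x) = x E[1 - exp(- v)]: the
    error is bounded by A(x) - A(x / 2) = x / 2 E[(1 - exp(- v))^2], which is
    negligible because A(x) ~ h l(x) is slowly varying. *)

(** * Weierstrass approximation by Bernstein polynomials *)

(** The factors [c_n] grow without bound, so the rescaled laws are not probabilities to which a
    continuity theorem applies. The weight [1 - exp(- z)] repairs this: the measures
    [c_n (1 - exp(- z)) P(Z_n in dz)] have bounded mass, and their integrals against powers of
    [exp(- z)] are differences of convergent Laplace functionals. Uniform polynomial approximation
    then gives convergence of the whole sequence [U_n(x)], without subsequences or a limit measure.
    The integrand [min(z, x)] replaces the indicator of [z > x] because its quotient by
    [1 - exp(- z)] extends continuously in [exp(- z)] to all of [[0, 1]], and because its concavity
    in [x] survives the limit: concavity supplies the continuity, the right derivative and the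
    squeeze. For alpha = 1 the same limit would satisfy [U(r x) = U(x)], hence be constant by
    monotonicity with derivative zero. The tail limit degenerates, so the truncated first moment is
    estimated directly from the Laplace transform. *)

Section weierstrass.
Context {R : realType}.
Implicit Types (f g : nat -> R) (x y eps : R).

(* At y this is the expectation of f(S) for S binomial(n, y); the recursion
   conditions on the first trial. *)
Fixpoint bernstein_poly n f : {poly R} :=
  if n is m.+1 then
    'X * bernstein_poly m (fun k => f k.+1) + (1 - 'X) * bernstein_poly m f
  else (f 0%N)%:P.

Lemma horner_bernsteinS n f y :
  (bernstein_poly n.+1 f).[y] =
  y * (bernstein_poly n (fun k => f k.+1)).[y] +
  (1 - y) * (bernstein_poly n f).[y].
Proof. by rewrite /= !hornerE. Qed.

Lemma bernstein_poly_le n f g y : 0 <= y <= 1 ->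
  (forall k, (k <= n)%N -> f k <= g k) ->
  (bernstein_poly n f).[y] <= (bernstein_poly n g).[y].
Proof.
move=> y01; elim: n f g => [|n IH] f g fg.
  by rewrite /= !hornerC fg.
have /andP[y0 y1] := y01.
rewrite !horner_bernsteinS lerD// ler_wpM2l ?subr_ge0//; apply: IH => k kn.
  exact: fg.
by apply: fg; rewrite ltnW.
Qed.

(** Binomial second moment about [b]: squared bias plus variance. The center must be arbitrary,
    because conditioning on the first trial shifts it by one. *)
Lemma bernstein_poly_quadratic n y (a b c : R) :
  (bernstein_poly n (fun k => a * (k%:R - b) ^+ 2 + c)).[y] =
  a * ((n%:R * y - b) ^+ 2 + n%:R * (y * (1 - y))) + c.
Proof.
elim: n b => [|n IH] b.
  by rewrite /= hornerC; ring.
rewrite horner_bernsteinS IH.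
rewrite (_ : (fun k => _) = (fun k => a * (k%:R - (b - 1)) ^+ 2 + c)).
  by rewrite IH -[in RHS]natr1; ring.
by apply/funext => k; rewrite -natr1; congr (_ * _ ^+ 2 + _); ring.
Qed.

(** Compactness in near-covering form: the estimate need only hold for points near a given [x] and
    for all small [dl]. There both points are compared with [x], which is why the radius [e] is
    halved. *)
Lemma uniform_continuity_itv (f : R -> R) (a b : R) :
  {within `[a, b], continuous f} -> forall eps, 0 < eps ->
  exists2 delta : R, 0 < delta & forall x y, x \in `[a, b] -> y \in `[a, b] ->
    `|x - y| < delta -> `|f x - f y| <= eps.
Proof.
move=> cf eps eps0.
have /compact_near_coveringP/near_covering_withinP := @segment_compact R a b.
move=> /(_ _ (0^'+) (fun dl x => forall y, y \in `[a, b] ->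
    `|x - y| < dl -> `|f x - f y| <= eps)) /(_ _) [].
  move=> x xab.
  have /subspace_continuousP/(_ x xab)/cvgrPdist_lt := cf.
  move=> /(_ _ (divr_gt0 eps0 (ltr0Sn R 1))).
  move=> [e /= e0 he].
  near=> z dl => zab y yab zy.
  have xz : `|x - z| < e / 2.
    by near: z; apply: nbhsx_ballx; rewrite divr_gt0.
  have dle : dl < e / 2.
    by near: dl; apply: nbhs_right_lt; rewrite divr_gt0.
  have xye : `|x - y| < e.
    by rewrite [ltRHS]splitr (le_lt_trans (ler_distD z _ _))// ltrD// (lt_trans zy).
  have xze : `|x - z| < e.
    by rewrite (lt_trans xz)// ltr_pdivrMr// ltr_pMr// ltr1n.
  rewrite ltW// (le_lt_trans (ler_distD (f x) _ _))// [ltRHS]splitr.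
  by rewrite ltrD// ?[`|f z - _|]distrC; exact: he.
move=> e /= e0 he.
exists (e / 2); first by rewrite divr_gt0.
move=> x y xab yab xy.
apply: (he (e / 2) _ _ x) => //=.
  by rewrite sub0r normrN gtr0_norm ?divr_gt0// ltr_pdivrMr// ltr_pMr// ltr1n.
by rewrite divr_gt0.
Unshelve. all: by end_near. Qed.

(** Chebyshev's argument: the error at [k / N] is at most [eps / 2] when [k / N] is close to [y],
    and is dominated by a multiple of [(k / N - y) ^+ 2] otherwise. The sum of the two bounds is
    quadratic in [k], so its binomial mean is explicit. *)
Lemma weierstrass_approximation (f : R -> R) :
  {within `[0, 1], continuous f} -> forall eps, 0 < eps ->
  exists p : {poly R}, forall y, 0 <= y <= 1 -> `|f y - p.[y]| <= eps.
Proof.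
move=> cf eps eps0.
have e2 : 0 < eps / 2 by rewrite divr_gt0.
have [dl dl0 hdl] := uniform_continuity_itv cf e2.
have [M hM] : exists M : R, forall y, 0 <= y <= 1 -> `|f y| <= M.
  have [a _ ha] := EVT_max ler01 cf.
  have [b _ hb] := EVT_min ler01 cf.
  exists (`|f a| + `|f b|) => y y01.
  have := ha y; rewrite in_itv/= => /(_ y01) fya.
  have := hb y; rewrite in_itv/= => /(_ y01) fyb.
  rewrite ler_norml (le_trans fya) ?andbT; last first.
    by rewrite (le_trans (ler_norm _))// lerDl.
  rewrite (le_trans _ fyb)//.
  by have := ler_norm (- f b); rewrite normrN; have := normr_ge0 (f a); lra.
(* With this [K], [K * (k / N - y) ^+ 2] reaches the trivial bound [2 * M] as soon as [k / N] is at
   distance [dl] from [y]. *)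
pose K := 2 * M / dl ^+ 2.
have M0 : 0 <= M by apply: le_trans (hM 0 _) => //; rewrite lexx ler01.
have K0 : 0 <= K by rewrite /K divr_ge0 ?mulr_ge0 ?exprn_ge0 ?(ltW dl0).
pose N := (Num.truncn (K / (eps / 2))).+1.
have N0 : 0 < N%:R :> R by rewrite ltr0n.
have hN : K / N%:R <= eps / 2.
  rewrite ler_pdivrMr// mulrC -ler_pdivrMr// ltW//; exact: truncnS_gt.
exists (bernstein_poly N (fun k => f (k%:R / N%:R))) => y y01.
have /andP[y0 y1] := y01.
have key k : (k <= N)%N ->
    `|f (k%:R / N%:R) - f y| <= K / N%:R ^+ 2 * (k%:R - N%:R * y) ^+ 2 + eps / 2.
  move=> kN.
  have k01 : 0 <= (k%:R / N%:R : R) <= 1.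
    by rewrite divr_ge0//= ler_pdivrMr// mul1r ler_nat.
  have -> : K / N%:R ^+ 2 * (k%:R - N%:R * y) ^+ 2 =
      K * (k%:R / N%:R - y) ^+ 2.
    by field; rewrite lt0r_neq0.
  have [kydl|dlky] := ltP `|k%:R / N%:R - y| dl.
    rewrite (le_trans (hdl _ _ _ _ kydl)) ?in_itv//= lerDr.
    by rewrite mulr_ge0// exprn_even_ge0.
  rewrite ler_wpDr ?(ltW e2)//.
  have : dl ^+ 2 <= (k%:R / N%:R - y) ^+ 2.
    by rewrite -(real_normK (num_real (_ - y))) ler_pXn2r ?nnegrE// ltW.
  move=> h; apply: (@le_trans _ _ (2 * M)).
    by rewrite (le_trans (ler_normB _ _))// mulr2n mulrDl mul1r lerD// hM.
  by rewrite /K -mulrA ler_peMr ?mulr_ge0// mulrC ler_pdivlMr ?mul1r// exprn_gt0.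
have y14 : y * (1 - y) <= 1.
  by rewrite -[leRHS]mulr1 ler_pM ?subr_ge0// lerBlDr lerDl.
have bnd (s : R) : K / N%:R ^+ 2 *
    ((N%:R * y - N%:R * y) ^+ 2 + N%:R * (y * (1 - y))) + s <= eps / 2 + s.
  rewrite lerD2r subrr expr0n/= add0r (le_trans _ hN)//.
  have -> : K / N%:R ^+ 2 * (N%:R * (y * (1 - y))) = K / N%:R * (y * (1 - y)).
    by field; rewrite lt0r_neq0.
  by rewrite ler_piMr// divr_ge0// ltW.
rewrite ler_norml; apply/andP; split.
- rewrite lerBrDr addrC lerBlDr.
  have := @bernstein_poly_le N (fun k => f (k%:R / N%:R))
    (fun k => K / N%:R ^+ 2 * (k%:R - N%:R * y) ^+ 2 + (f y + eps / 2)) y y01.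
  rewrite bernstein_poly_quadratic => h; apply: le_trans (h _) _.
    move=> k /key; rewrite ler_norml => /andP[_]; lra.
  by rewrite (le_trans (bnd _))//; lra.
- rewrite lerBlDr.
  have := @bernstein_poly_le N
    (fun k => - (K / N%:R ^+ 2) * (k%:R - N%:R * y) ^+ 2 + (f y - eps / 2))
    (fun k => f (k%:R / N%:R)) y y01.
  rewrite bernstein_poly_quadratic => h.
  have := bnd 0; rewrite !addr0 => b0.
  apply: le_trans (lerD (lexx eps) (h _)).
    by move: b0; rewrite mulNr; lra.
  by move=> k /key; rewrite ler_norml => /andP[+ _]; rewrite mulNr; lra.
Qed.

End weierstrass.

(** * Integrability and measurability criteria *)

Lemma integrable_le_cst d (T : measurableType d) (R : realType)
    (mu : {measure set T -> \bar R}) (D : set T) (f : T -> R) (M : R) :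
  measurable D -> (mu D < +oo)%E -> measurable_fun D f ->
  (forall x, D x -> `|f x| <= M) -> mu.-integrable D (EFin \o f).
Proof.
move=> mD muD mf fM; apply: measurable_bounded_integrable => //.
exists M; split; first exact: num_real.
by move=> N MN x Dx; apply: le_trans (fM _ Dx) (ltW MN).
Qed.

(** [f] is the limit of the step functions [f (y n x)], where [y n x] is the first point of the grid
    of mesh [1 / (n + 1)] strictly to the right of [x]; approaching from the right is what
    right-continuity can handle. *)
Lemma right_continuous_measurable (R : realType) (f : R -> R) :
  (forall x, 0 < x -> f y @[y --> x^'+] --> f x) ->
  measurable_fun (`]0, +oo[ : set R) f.
Proof.
move=> rcf.
pose y (n : nat) (x : R) : R := (Num.truncn (n.+1%:R * x)).+1%:R / n.+1%:R.
have yl n x : x < y n x.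
  by rewrite /y ltr_pdivlMr// mulrC truncnS_gt.
have yr n x : 0 < x -> y n x <= x + n.+1%:R^-1.
  move=> x0; rewrite /y ler_pdivrMr// mulrDl mulVf// -natr1 lerD2r [leRHS]mulrC.
  by rewrite truncn_le mulr_ge0// ltW.
apply: (measurable_fun_cvg (h := fun n x => f (y n x))).
- move=> n mD B mB.
  rewrite (_ : _ `&` _ = \bigcup_(k in [set k | B (f (k.+1%:R / n.+1%:R))])
      (`]0, +oo[ `&` `[k%:R / n.+1%:R, k.+1%:R / n.+1%:R[)).
    by apply: bigcup_measurable => k _; apply: measurableI.
  apply/seteqP; split => x.
    move=> [x0 Bx]; exists (Num.truncn (n.+1%:R * x)) => //; split => //=.
    move: x0; rewrite /= !in_itv/= andbT => x0.
    have := truncn_itv (mulr_ge0 (ler0n R n.+1) (ltW x0)).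
    by rewrite ler_pdivrMr// ltr_pdivlMr// mulrC.
  move=> [k /= Bk [x0 xk]]; split => //.
  suff : Num.truncn (n.+1%:R * x) = k by rewrite /y /= => ->.
  apply: truncn_def.
  by move: xk; rewrite in_itv/= ler_pdivrMr// ltr_pdivlMr// mulrC.
- move=> x; rewrite /= in_itv/= andbT => x0.
  apply/cvgrPdist_lt => e e0.
  have /cvgrPdist_lt/(_ _ e0)[dl /= dl0 hdl] := rcf _ x0.
  near=> n; apply: hdl => //=.
  rewrite ltr0_norm ?subr_lt0// opprB ltrBlDl (le_lt_trans (yr _ _ _))// ltrD2l.
  near: n; exact: near_infty_natSinv_lt (PosNum dl0).
Unshelve. all: by end_near. Qed.

(** * Right derivatives of concave functions *)

Section concave.
Context {R : realType}.
Variable U : R -> R.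

(** The right derivative of a concave [U]: its difference quotients increase as [y] decreases to
    [x], so their limit is a supremum, whose existence only needs an upper bound. *)
Definition right_slope (x : R) : R :=
  sup [set (U y - U x) / (y - x) | y in `]x, +oo[].

Hypothesis U_concave : forall x y z, 0 < x -> x < y -> y < z ->
  (U z - U y) * (y - x) <= (U y - U x) * (z - y).

Let has_sup_slope x : 0 < x ->
  has_sup [set (U y - U x) / (y - x) | y in `]x, +oo[].
Proof.
move=> x0; split.
  exists ((U (x + 1) - U x) / (x + 1 - x)), (x + 1) => //=.
  by rewrite in_itv/= andbT ltrDl.
(* By concavity the slope over [[x / 2, x]] dominates every slope to the right of [x]. *)
exists ((U x - U (x / 2)) / (x - x / 2)) => _ /= [y /[!in_itv]/= /[!andbT] xy <-].
rewrite ler_pdivrMr ?subr_gt0// mulrAC ler_pdivlMr ?subr_gt0; last first.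
  by rewrite ltr_pdivrMr// ltr_pMr// ltr1n.
apply: U_concave => //; first by rewrite divr_gt0.
by rewrite ltr_pdivrMr// ltr_pMr// ltr1n.
Qed.

Lemma le_right_slope x y : 0 < x -> x < y ->
  U y - U x <= (y - x) * right_slope x.
Proof.
move=> x0 xy; rewrite mulrC -ler_pdivrMr ?subr_gt0//.
apply: sup_upper_bound; first exact: has_sup_slope.
by exists y => //=; rewrite in_itv/= xy.
Qed.

Lemma right_slope_le x b : 0 < x ->
  (forall y, x < y -> U y - U x <= (y - x) * b) -> right_slope x <= b.
Proof.
move=> x0 h; apply: ge_sup; first by have [] := has_sup_slope x0.
move=> _ /= [y /[!in_itv]/= /[!andbT] xy <-].
by rewrite ler_pdivrMr ?subr_gt0// mulrC h.
Qed.

Lemma ge_right_slope x y : 0 < x -> x < y ->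
  (y - x) * right_slope y <= U y - U x.
Proof.
move=> x0 xy; rewrite mulrC -ler_pdivlMr ?subr_gt0//.
apply: right_slope_le; first exact: lt_trans xy.
move=> z yz; rewrite mulrA ler_pdivlMr ?subr_gt0// [leRHS]mulrC.
exact: U_concave.
Qed.

Lemma right_slope_nincr x y : 0 < x -> x <= y -> right_slope y <= right_slope x.
Proof.
move=> x0; rewrite le_eqVlt => /predU1P[->//|xy].
rewrite -(ler_pM2l (_ : 0 < y - x)) ?subr_gt0//.
exact: le_trans (ge_right_slope x0 xy) (le_right_slope x0 xy).
Qed.

Lemma right_slope_right_continuous x : 0 < x ->
  right_slope y @[y --> x^'+] --> right_slope x.
Proof.
move=> x0; apply/cvgrPdist_le => e e0.
have e2 : 0 < e / 2 by rewrite divr_gt0.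
(* The supremum is nearly attained at some [z]. For [y] between, the increment over [[x, z]] is at
   most [(y - x) * right_slope x + (z - y) * right_slope y], which bounds [right_slope y] from
   below; [y < (x + z) / 2] keeps [z - y] above half of [z - x]. *)
have [_ /= [z /[!in_itv]/= /[!andbT] xz <-]] := sup_adherent e2 (has_sup_slope x0).
rewrite -/(right_slope x) ltr_pdivlMr ?subr_gt0// => hz.
near=> y.
have xy : x < y by near: y; exact: nbhs_right_gt.
have yz : y < (x + z) / 2.
  by near: y; apply: nbhs_right_lt; rewrite ltr_pdivlMr// mulrC; lra.
have y0 := lt_trans x0 xy.
have yz' : y < z by lra.
have h1 := le_right_slope x0 xy.
have h2 := le_right_slope y0 yz'.
rewrite ger0_norm ?subr_ge0 ?right_slope_nincr ?(ltW xy)//.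
rewrite -(ler_pM2l (_ : 0 < z - y)) ?subr_gt0//.
have : (z - x) * (e / 2) <= (z - y) * e.
  rewrite [X in _ <= X](_ : _ = (2 * (z - y)) * (e / 2)); last by field.
  by rewrite ler_pM2r//; lra.
move=> h3; have h4 : (right_slope x - e / 2) * (z - x) <=
    (z - y) * right_slope y + (y - x) * right_slope x by lra.
by rewrite mulrBr; lra.
Unshelve. all: by end_near. Qed.

Lemma concave_continuous x : 0 < x -> {for x, continuous U}.
Proof.
move=> x0; have x20 : 0 < x / 2 by rewrite divr_gt0.
have x2x : x / 2 < x by rewrite ltr_pdivrMr// ltr_pMr// ltr1n.
(* Slopes decrease, so on [[x / 2, 2 * x]] they lie between the values at the two ends and [U] is
   [C]-Lipschitz there; the summand 1 keeps [C] positive. *)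
pose C := `|right_slope (x / 2)| + `|right_slope (2 * x)| + 1.
have C0 : 0 < C by rewrite ltr_wpDl// addr_ge0.
apply/cvgrPdist_le => e e0; near=> y.
have x2y : x / 2 < y by near: y; exact: lt_nbhsr.
have yx2 : y < 2 * x by near: y; apply: lt_nbhsl; rewrite ltr_pMl// ltr1n.
have key a b : x / 2 <= a -> a < b -> b <= 2 * x -> `|U b - U a| <= (b - a) * C.
  move=> xa ab bx; have a0 := lt_le_trans x20 xa.
  have b0 := lt_trans a0 ab.
  have ba : 0 < b - a by rewrite subr_gt0.
  have h1 := le_right_slope a0 ab; have h2 := ge_right_slope a0 ab.
  have h3 := right_slope_nincr x20 xa.
  have h4 := right_slope_nincr b0 bx.
  rewrite ler_norml -mulrN (le_trans _ h2) ?(le_trans h1)//.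
    rewrite ler_pM2l// (le_trans h3)// /C (le_trans (ler_norm _))//.
    by rewrite -addrA lerDl addr_ge0.
  rewrite ler_pM2l// (le_trans _ h4)// /C lerNl (le_trans (ler_norm _))// normrN.
  by rewrite -addrA addrCA lerDl addr_ge0.
have xye : `|x - y| < e / C.
  by near: y; apply: (@nbhsx_ballx R R x (e / C)); rewrite divr_gt0.
have [xy|yx|->] := ltgtP x y.
- rewrite distrC (le_trans (key x y _ _ _)) ?(ltW yx2) ?(ltW x2x)//.
  rewrite -ler_pdivlMr// (le_trans _ (ltW xye))//.
  by rewrite distrC ler_norm.
- rewrite (le_trans (key y x _ _ _)) ?(ltW x2y)//.
    by rewrite ler_peMl ?(ltW x0)// ler1n.
  by rewrite -ler_pdivlMr// (le_trans _ (ltW xye))// ler_norm.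
- by rewrite subrr normr0 ltW.
Unshelve. all: by end_near. Qed.

End concave.

(** * The fundamental theorem of calculus for concave functions *)

Section concave_integral.
Context {R : realType}.
Notation mu := (@lebesgue_measure R).
Variable U : R -> R.
Hypothesis U_concave : forall x y z, 0 < x -> x < y -> y < z ->
  (U z - U y) * (y - x) <= (U y - U x) * (z - y).
Hypothesis U_nd : forall x y, 0 < x -> x <= y -> U x <= U y.
Hypothesis U_cvg0 : U x @[x --> 0^'+] --> 0.
Local Notation u := (right_slope U).

Lemma right_slope_ge0 x : 0 < x -> 0 <= u x.
Proof.
move=> x0; have xx1 : x < x + 1 by rewrite ltrDl.
have := le_right_slope U_concave x0 xx1.
rewrite (_ : x + 1 - x = 1) ?mul1r; last by ring.
apply: le_trans.
by rewrite subr_ge0 U_nd// ltW.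
Qed.

Lemma measurable_right_slope : measurable_fun (`]0, +oo[ : set R) u.
Proof.
by apply: right_continuous_measurable => x; exact: right_slope_right_continuous.
Qed.

Let integrable_u a b : 0 < a -> mu.-integrable `]a, b] (EFin \o u).
Proof.
move=> a0; apply: (@integrable_le_cst _ _ _ _ _ _ (u a)) => //.
- by rewrite /= lebesgue_measure_itv/=; case: ifPn => // _; rewrite -EFinB ltry.
- apply: measurable_funS measurable_right_slope => //.
  by move=> x /=; rewrite !in_itv/= andbT => /andP[/(lt_trans a0)].
- move=> x /=; rewrite in_itv/= => /andP[ax _].
  rewrite ger0_norm ?right_slope_ge0// ?(lt_trans a0)//.
  by rewrite right_slope_nincr// ltW.
Qed.

(* Bisecting an interval halves the bound on the defect, because the variation of
   right_slope is additive; hence the defect vanishes. *)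
Let defect a b := U b - U a - \int[mu]_(x in `]a, b]) u x.

Let defect_le a b : 0 < a -> a < b -> `|defect a b| <= (b - a) * (u a - u b).
Proof.
move=> a0 ab; have h1 := le_right_slope U_concave a0 ab.
have h2 := ge_right_slope U_concave a0 ab.
have mcst (c : R) : \int[mu]_(x in `]a, b]) c = (b - a) * c.
  by rewrite Rintegral_cst//= lebesgue_measure_itv/= lte_fin ab -EFinB/= mulrC.
have icst (c : R) : mu.-integrable `]a, b] (EFin \o cst c).
  apply: (@integrable_le_cst _ _ _ _ _ _ `|c|) => //.
  by rewrite /= lebesgue_measure_itv/=; case: ifPn => // _; rewrite -EFinB ltry.
have h3 : \int[mu]_(x in `]a, b]) u x <= (b - a) * u a.
  rewrite -mcst; apply: le_Rintegral => //; [exact: integrable_u|exact: icst|].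
  move=> x /=; rewrite in_itv/= => /andP[ax _].
  by rewrite right_slope_nincr// ltW.
have h4 : (b - a) * u b <= \int[mu]_(x in `]a, b]) u x.
  rewrite -mcst; apply: le_Rintegral => //; [exact: icst|exact: integrable_u|].
  move=> x /=; rewrite in_itv/= => /andP[ax xb].
  by rewrite right_slope_nincr// (lt_trans a0).
rewrite ler_norml /defect mulrBr; move: h1 h2 h3 h4.
by move: (Rintegral _ _ _) => I; lra.
Qed.

Let defectD a b c : 0 < a -> a < b -> b < c ->
  defect a c = defect a b + defect b c.
Proof.
move=> a0 ab bc; rewrite /defect.
have := @Rintegral_itvB R u (BRight a) (BRight c) b (integrable_u _ a0).
rewrite !bnd_simp => /(_ (ltW ab) (ltW bc)) <-.
by rewrite -[X in X - U b]addr0; ring.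
Qed.

Let defect_le_exp n a b : 0 < a -> a < b ->
  `|defect a b| <= (b - a) * (u a - u b) / 2 ^+ n.
Proof.
elim: n a b => [|n IH] a b a0 ab; first by rewrite expr0 divr1 defect_le.
have am : a < (a + b) / 2 by lra.
have mb : (a + b) / 2 < b by lra.
rewrite (defectD a0 am mb) (le_trans (ler_normD _ _))//.
have := IH _ _ a0 am; have := IH _ _ (lt_trans a0 am) mb.
set m := (a + b) / 2.
have -> : b - m = (b - a) / 2 by rewrite /m; field.
have -> : m - a = (b - a) / 2 by rewrite /m; field.
move=> h1 h2; apply: le_trans (lerD h2 h1) _.
rewrite -mulrDl -mulrDr exprS invfM mulrA ler_pM2r ?invr_gt0 ?exprn_gt0//.
by rewrite le_eqVlt; apply/orP; left; apply/eqP; field.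
Qed.

Lemma integral_right_slope_itv a b : 0 < a -> a < b ->
  \int[mu]_(x in `]a, b]) u x = U b - U a.
Proof.
move=> a0 ab; apply/esym/eqP; rewrite -subr_eq0 -normr_le0.
rewrite -/(defect a b); apply/ler_addgt0Pr => e e0; rewrite add0r.
pose K := (b - a) * (u a - u b).
have K0 : 0 <= K.
  by rewrite mulr_ge0// subr_ge0 ?(ltW ab)// right_slope_nincr// ltW.
pose n := (Num.truncn (K / e)).+1.
apply: le_trans (defect_le_exp n a0 ab) _.
rewrite -/K ler_pdivrMr ?exprn_gt0// -ler_pdivrMl// mulrC.
rewrite (le_trans (ltW (truncnS_gt _)))// -/n -natrX ler_nat.
by rewrite ltnW// ltn_expl.
Qed.

(** The slope may be unbounded near 0, so the integral is obtained by monotone convergence from the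
    intervals []x / (n + 2), x]], the lower endpoint contributing [U (x / (n + 2))], which vanishes
    in the limit. The shift by 2 keeps these intervals nonempty. *)
Lemma integral_right_slope x : 0 < x ->
  (\int[mu]_(y in `]0%R, x]) (u y)%:E = (U x)%:E)%E.
Proof.
move=> x0.
have -> : `]0, x]%classic = \bigcup_n `]x / n.+2%:R, x]%classic :> set R.
  apply/seteqP; split => y /=.
    rewrite in_itv/= => /andP[y0 yx].
    exists (Num.truncn (x / y)) => //=; rewrite in_itv/= yx andbT.
    rewrite ltr_pdivrMr// mulrC -ltr_pdivrMr//.
    by rewrite (lt_trans (truncnS_gt _))// ltr_nat.
  move=> [n _] /=; rewrite !in_itv/= => /andP[h ->]; rewrite andbT.
  by rewrite (lt_trans _ h)// divr_gt0.
have xn n : 0 < x / n.+2%:R by rewrite divr_gt0.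
have xnx n : x / n.+2%:R < x by rewrite ltr_pdivrMr// ltr_pMr// ltr1n.
have cvgI : (\int[mu]_(y in `](x / n.+2%:R)%R, x]) (u y)%:E @[n --> \oo] -->
    \int[mu]_(y in \bigcup_n `](x / n.+2%:R)%R, x]%classic) (u y)%:E)%E.
  apply: (@ge0_nondecreasing_set_cvg_integral _ (measurableTypeR R) R
      (fun n => [set` `](x / n.+2%:R)%R, x]]) (EFin \o u) mu) => //.
  - move=> m n mn; apply/subsetPset => y /=; rewrite !in_itv/= => /andP[h ->].
    rewrite andbT (le_lt_trans _ h)// ler_pM2l// lef_pV2 ?posrE//.
    by rewrite ler_nat !ltnS.
  - by move=> n; have /integrableP[] := integrable_u x (xn n).
  - move=> n y /=; rewrite in_itv/= => /andP[h _].
    by rewrite lee_fin right_slope_ge0// (lt_trans _ h).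
apply: cvg_unique cvgI _ => //.
have -> : (fun n => \int[mu]_(y in `](x / n.+2%:R)%R, x]) (EFin \o u) y)%E =
      (fun n => (U x - U (x / n.+2%:R))%:E).
    apply/funext => n; rewrite -integral_right_slope_itv//.
    by rewrite -[LHS]fineK//; apply: integrable_fin_num => //; exact: integrable_u.
  apply/cvg_EFin; first by near=> n.
  rewrite -[X in _ --> X]subr0; apply: cvgB; first exact: cvg_cst.
  apply/cvgrPdist_lt => e e0.
  have /cvgrPdist_lt/(_ _ e0)[dl /= dl0 hdl] := U_cvg0.
  near=> n; apply: hdl => //=.
  rewrite sub0r normrN gtr0_norm// ltr_pdivrMr// mulrC -ltr_pdivrMr//.
  apply: (@lt_trans _ _ n%:R); last by rewrite ltr_nat.
  by near: n; exact: nbhs_infty_gtr.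
Unshelve. all: by end_near. Qed.

End concave_integral.

(** * Truncated means *)

Section truncated_mean.
Context d (T : measurableType d) (R : realType) (P : probability T R).
Variables (Z : nat -> T -> R) (c : nat -> R) (L : R -> R).
Hypothesis mZ : forall n, measurable_fun setT (Z n).
Hypothesis Z_ge0 : forall n w, 0 <= Z n w.
Hypothesis c_ge0 : forall n, 0 <= c n.
Hypothesis cvg_L : forall s, 0 < s ->
  c n * \int[P]_w (1 - expR (- (s * Z n w))) @[n --> \oo] --> L s.

Definition truncated_mean n (x : R) := c n * \int[P]_w Num.min (Z n w) x.

Let E n (g : R -> R) := \int[P]_w g (Z n w).

(** Boundedness is asked on the half-line only, where [Z n] takes its values: [exp(- z)] is not
    bounded elsewhere. The class is stable under ring operations, which settles every integrability
    question below. *)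
Let good (g : R -> R) := measurable_fun setT g /\
  exists M, forall z, 0 <= z -> `|g z| <= M.

Let good_int n g : good g -> P.-integrable setT (EFin \o (g \o Z n)).
Proof.
move=> [mg [M gM]]; apply: (@integrable_le_cst _ _ _ _ _ _ M) => //.
- by rewrite /= probability_setT ltry.
- exact: measurableT_comp.
- by move=> w _ /=; exact: gM.
Qed.

Let goodB g h : good g -> good h -> good (fun z => g z - h z).
Proof.
move=> [mg [M gM]] [mh [N hN]]; split; first exact: measurable_funB.
by exists (M + N) => z z0; rewrite (le_trans (ler_normB _ _))// lerD ?gM ?hN.
Qed.

Let goodD g h : good g -> good h -> good (fun z => g z + h z).
Proof.
move=> [mg [M gM]] [mh [N hN]]; split; first exact: measurable_funD.
by exists (M + N) => z z0; rewrite (le_trans (ler_normD _ _))// lerD ?gM ?hN.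
Qed.

Let goodM g h : good g -> good h -> good (fun z => g z * h z).
Proof.
move=> [mg [M gM]] [mh [N hN]]; split; first exact: measurable_funM.
by exists (M * N) => z z0; rewrite normrM ler_pM ?gM ?hN.
Qed.

Let good_cst a : good (fun=> a).
Proof. by split; [exact: measurable_cst|exists `|a|]. Qed.

Let good_exp a : 0 <= a -> good (fun z => expR (- (a * z))).
Proof.
move=> a0; split.
  under eq_fun do rewrite -mulNr.
  exact: measurableT_comp (mulrl_measurable _).
exists 1 => z z0; rewrite ger0_norm ?expR_ge0// -expR0 ler_expR.
by rewrite oppr_le0 mulr_ge0.
Qed.

Let good_exp1 : good (fun z => expR (- z)).
Proof.
have := good_exp ler01.
by rewrite (_ : (fun z => expR (- (1 * z))) = (fun z => expR (- z)))//;
  apply/funext => z; rewrite mul1r.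
Qed.

Let good_min x : 0 < x -> good (fun z => Num.min z x).
Proof.
move=> x0; split; first exact: measurable_minr.
by exists x => z z0; rewrite ger0_norm ?ge_min ?lexx ?orbT// le_min z0 ltW.
Qed.

Let E_le n g h : good g -> good h -> (forall z, 0 <= z -> g z <= h z) ->
  E n g <= E n h.
Proof.
move=> gg gh gh'; apply: le_Rintegral => //; [exact: good_int|exact: good_int|].
by move=> w _; exact: gh'.
Qed.

Let E_D n g h : good g -> good h -> E n (fun z => g z + h z) = E n g + E n h.
Proof. by move=> gg gh; apply: RintegralD => //; exact: good_int. Qed.

Let E_B n g h : good g -> good h -> E n (fun z => g z - h z) = E n g - E n h.
Proof. by move=> gg gh; apply: RintegralB => //; exact: good_int. Qed.

Let E_Z n a g : good g -> E n (fun z => a * g z) = a * E n g.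
Proof. by move=> gg; apply: RintegralZl => //; exact: good_int. Qed.

Let good_1exp a : 0 <= a -> good (fun z => 1 - expR (- (a * z))).
Proof. by move=> a0; apply: goodB; [exact: good_cst|exact: good_exp]. Qed.

Let good_pow k : good (fun z => expR (- z) ^+ k).
Proof.
elim: k => [|k IH]; first exact: good_cst.
rewrite (_ : (fun z => _) = (fun z => expR (- z) * expR (- z) ^+ k)).
  exact: goodM.
by apply/funext => z; rewrite exprS.
Qed.

Let cvg_exp (k : nat) :
  cvgn (fun n => c n * E n (fun z => 1 - expR (- (k%:R * z)))).
Proof.
have [->|k0] := posnP k; last first.
  by apply/cvg_ex; exists (L k%:R); apply: cvg_L; rewrite ltr0n.
rewrite (_ : (fun n => _) = fun=> 0); first exact: is_cvg_cst.
apply/funext => n; rewrite (_ : (fun z => _) = fun=> 0).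
  by rewrite /E Rintegral_cst// mul0r mulr0.
by apply/funext => z; rewrite mul0r oppr0 expR0 subrr.
Qed.

(** With [y = exp(- z)], [(1 - y) y^k = (1 - y^(k+1)) - (1 - y^k)] is a difference of two functions
    whose rescaled means converge. The power [k] is free because the induction on [p * 'X + a] moves
    the factor ['X] into it. *)
Let good_poly_cvg (p : {poly R}) k :
  good (fun z => (1 - expR (- z)) * expR (- z) ^+ k * p.[expR (- z)]) /\
  cvgn (fun n => c n *
    E n (fun z => (1 - expR (- z)) * expR (- z) ^+ k * p.[expR (- z)])).
Proof.
have g1e j : good (fun z => (1 - expR (- z)) * expR (- z) ^+ j).
  by apply: goodM => //; apply: goodB => //; exact: good_cst.
elim/poly_ind: p k => [|p a IH] k.
  rewrite (_ : (fun z => _) = fun=> 0); last first.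
    by apply/funext => z; rewrite horner0 mulr0.
  split; first exact: good_cst.
  rewrite (_ : (fun n => _) = fun=> 0); first exact: is_cvg_cst.
  by apply/funext => n; rewrite /E Rintegral_cst// mul0r mulr0.
have [gk ck] := IH k.+1.
rewrite (_ : (fun z => _) = fun z =>
  (1 - expR (- z)) * expR (- z) ^+ k.+1 * p.[expR (- z)] +
  a * ((1 - expR (- z)) * expR (- z) ^+ k)); last first.
  by apply/funext => z; rewrite hornerD hornerM hornerX hornerC exprS; ring.
have ga : good (fun z => a * ((1 - expR (- z)) * expR (- z) ^+ k)).
  by apply: goodM => //; exact: good_cst.
split; first exact: goodD.
rewrite (_ : (fun n => _) = (fun n => c n *
    E n (fun z => (1 - expR (- z)) * expR (- z) ^+ k.+1 * p.[expR (- z)]) +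
    a * (c n * E n (fun z => 1 - expR (- (k.+1%:R * z))) -
         c n * E n (fun z => 1 - expR (- (k%:R * z)))))).
  apply: is_cvgD => //; apply: is_cvgMr; apply: is_cvgB; exact: cvg_exp.
apply/funext => n; rewrite E_D// E_Z// -[X in _ = _ + a * X]mulrBr -E_B; last 2 first.
- exact: good_1exp.
- exact: good_1exp.
rewrite mulrDr; congr (_ + _); rewrite mulrCA; congr (_ * (_ * E n _)).
apply/funext => z; rewrite -!mulrN !expRM_natl exprS; ring.
Qed.

Let cvg_exp1 : c n * E n (fun z => 1 - expR (- z)) @[n --> \oo] --> L 1.
Proof.
have -> : (fun n => c n * E n (fun z => 1 - expR (- z))) =
    (fun n => c n * \int[P]_w (1 - expR (- (1 * Z n w)))).
  apply/funext => n; congr (_ * _).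
  by apply: eq_Rintegral => w _; rewrite mul1r.
exact: cvg_L ltr01.
Qed.

Let g1 : good (fun z => 1 - expR (- z)).
Proof. by apply: goodB => //; exact: good_cst. Qed.

(** Total mass of the weighted measures: an approximation error of order [eps * (1 - exp(- z))]
    costs at most [C * eps], uniformly in [n]. *)
Let bounded_exp : exists2 C, 0 < C & forall n, c n * E n (fun z => 1 - expR (- z)) <= C.
Proof.
have : cvgn (fun n => c n * E n (fun z => 1 - expR (- z))).
  by apply/cvg_ex; exists (L 1); exact: cvg_exp1.
move=> /cvg_seq_bounded [M [_ hM]].
exists (`|M| + 1); first by rewrite ltr_wpDl.
move=> n; rewrite (le_trans (ler_norm _))//; apply: hM => //.
by rewrite ltr_pwDr// ler_norm.
Qed.

Let expN1_ge (z : R) : 0 <= z -> Num.min z 1 <= 2 * (1 - expR (- z)).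
Proof.
move=> z0; have h : expR (- z) <= (1 + z)^-1.
  by rewrite expRN lef_pV2 ?posrE ?expR_gt0 ?expR_ge1Dx// ltr_wpDr.
have h2 : z / (1 + z) <= 1 - expR (- z).
  apply: (@le_trans _ _ (1 - (1 + z)^-1)); last by rewrite lerB.
  by rewrite le_eqVlt; apply/orP; left; apply/eqP; field; rewrite lt0r_neq0// ltr_wpDr.
rewrite -ler_pdivrMl// (le_trans _ h2)// ler_pdivlMr ?ltr_wpDr//.
by case: (leP z 1) => z1; nra.
Qed.

Let min_le (x z : R) : 0 < x -> 0 <= z ->
  Num.min z x <= 2 * (1 + x) * (1 - expR (- z)).
Proof.
move=> x0 z0; have h := ler_wpM2l (addr_ge0 ler01 (ltW x0)) (expN1_ge z0).
rewrite (_ : 2 * (1 + x) * _ = (1 + x) * (2 * (1 - expR (- z)))); last by ring.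
apply: le_trans h.
by case: (leP z x) => zx; case: (leP z 1) => z1; nra.
Qed.

(** Uniform in [n] and affine in [x]: this provides the dominating function when Laplace integrals
    of the truncated means pass to the limit. *)
Lemma truncated_mean_le : exists2 C, 0 < C &
  forall n x, 0 < x -> truncated_mean n x <= C * (1 + x).
Proof.
have [C C0 hC] := bounded_exp; exists (2 * C); first by rewrite mulr_gt0.
move=> n x x0.
have := @E_le n (fun z => Num.min z x) (fun z => 2 * (1 + x) * (1 - expR (- z))).
move=> /(_ (good_min x0) (goodM (good_cst _) g1) (fun z => @min_le x z x0)).
rewrite (E_Z _ _ g1) => /(ler_wpM2l (c_ge0 n)) h; apply: le_trans h _.
rewrite mulrCA (_ : 2 * C * (1 + x) = 2 * (1 + x) * C); last by ring.
by rewrite ler_wpM2l// mulr_ge0// addr_ge0// ltW.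
Qed.

Lemma truncated_mean_ge0 n x : 0 <= x -> 0 <= truncated_mean n x.
Proof.
by move=> x0; rewrite mulr_ge0// Rintegral_ge0// => w _; rewrite le_min Z_ge0.
Qed.

(** This is [min(- ln y, x) / (1 - y)], with the truncation moved inside the logarithm so that
    [y = 0], that is [z] at infinity, gives [x]. The value 1 at [y = 1], that is [z = 0], is the
    limit, as [- ln y] is equivalent to [1 - y]. *)
Let theta (x y : R) : R :=
  if y == 1 then 1 else - ln (Num.max y (expR (- x))) / (1 - y).

Let theta_continuous x : 0 < x -> {within `[0, 1], continuous (theta x)}.
Proof.
move=> x0.
have ct (y : R) : y < 1 -> {for y, continuous (theta x)}.
  move=> y1.
  have : (fun y => - ln (Num.max y (expR (- x))) / (1 - y)) @ y --> theta x y.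
    rewrite /theta lt_eqF//; apply: cvgM.
      apply: cvgN.
      apply: (@continuous_comp _ _ _ (fun y => Num.max y (expR (- x))) (@ln R)).
        by apply: continuous_max; [exact: cvg_id|exact: cvg_cst].
      apply: continuous_ln.
      by rewrite lt_max expR_gt0 orbT.
    apply: cvgV; first by rewrite subr_eq0 gt_eqF.
    by apply: cvgB; [exact: cvg_cst|exact: cvg_id].
  apply: cvg_trans; apply: near_eq_cvg; near=> z.
  by rewrite /theta lt_eqF//; near: z; exact: lt_nbhsl.
apply/continuous_within_itvP => //; split.
- by move=> y; rewrite in_itv/= => /andP[_]; exact: ct.
- by apply: cvg_at_right_filter; exact: ct.
- rewrite {2}/theta eqxx.
  (* Near 1 the truncation is inactive, and [1 - y <= - ln y <= y^-1 - 1], the last term being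
     [(1 - y) / y]. *)
  apply: (@squeeze_cvgr _ _ _ _ (fun=> 1) (fun y => y^-1)).
  + near=> y.
    have y1 : y < 1 by near: y; exact: nbhs_left_lt.
    have yx : expR (- x) < y.
      by near: y; apply: nbhs_left_gt; rewrite -expR0 ltr_expR oppr_lt0.
    have y0 : 0 < y := lt_trans (expR_gt0 _) yx.
    rewrite /theta lt_eqF// (max_idPl (ltW yx)) -lnV ?posrE//.
    rewrite ler_pdivlMr ?subr_gt0// ler_pdivrMr ?subr_gt0// mul1r.
    have l1 : ln y <= y - 1.
      by have := @le_ln1Dx R (y - 1); rewrite addrCA subrr addr0; apply; lra.
    have y'0 : 0 < y^-1 by rewrite invr_gt0.
    have l2 : ln y^-1 <= y^-1 - 1.
      by have := @le_ln1Dx R (y^-1 - 1); rewrite addrCA subrr addr0; apply; lra.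
    rewrite (le_trans l2) ?andbT; last by rewrite mulrBr mulr1 mulVf// gt_eqF.
    by rewrite lnV ?posrE// lerNr opprB.
  + exact: cvg_cst.
  + rewrite -[X in _ --> X]invr1; apply: cvgV; first exact: oner_neq0.
    by apply: cvg_at_left_filter; exact: cvg_id.
Unshelve. all: by end_near. Qed.

Let thetaE (x z : R) : 0 < x -> 0 <= z ->
  (1 - expR (- z)) * theta x (expR (- z)) = Num.min z x.
Proof.
move=> x0; rewrite /theta le_eqVlt => /predU1P[<-|z0].
  by rewrite oppr0 expR0 eqxx subrr mul0r (min_idPl (ltW x0)).
have e1 : expR (- z) < 1 by rewrite -expR0 ltr_expR oppr_lt0.
rewrite lt_eqF// mulrCA divff ?mulr1 ?subr_eq0 ?gt_eqF//.
case: (leP z x) => zx.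
  by rewrite max_l ?expRK ?opprK// ler_expR lerN2.
by rewrite max_r ?expRK ?opprK// ler_expR lerN2 ltW.
Qed.

Lemma is_cvg_truncated_mean x : 0 < x -> cvgn (truncated_mean ^~ x).
Proof.
move=> x0; apply: cauchy_cvg; apply: cauchy_exP => e e0.
have [C C0 hC] := bounded_exp.
(* A uniform error [e / (2 * C)] on [theta] becomes [e / (2 * C) * (1 - exp(- z))] on [min(z, x)],
   hence at most [e / 2] after taking means and multiplying by [c n], whatever [n]. *)
have eC0 : 0 < e / (2 * C) by rewrite divr_gt0// mulr_gt0.
have [p hp] := weierstrass_approximation (theta_continuous x0) eC0.
have [gp cp] := good_poly_cvg p 0%N.
set v := (fun n => c n * _) in cp.
have uv n : `|truncated_mean n x - v n| <= e / 2.
  have gm := good_min x0.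
  rewrite /v /truncated_mean -/(E n (fun z => Num.min z x)) -mulrBr -E_B//.
  rewrite normrM (ger0_norm (c_ge0 n)).
  apply: (@le_trans _ _ (c n * E n (fun z => e / (2 * C) * (1 - expR (- z))))).
    rewrite ler_wpM2l// ler_norml -[X in X <= _]mulN1r -E_Z; last first.
      by apply: goodM => //; exact: good_cst.
    have key z : 0 <= z ->
        `|Num.min z x - (1 - expR (- z)) * expR (- z) ^+ 0 * p.[expR (- z)]| <=
        e / (2 * C) * (1 - expR (- z)).
      move=> z0; rewrite -(thetaE x0 z0) expr0 mulr1 -mulrBr normrM.
      have e1 : expR (- z) <= 1 by rewrite -expR0 ler_expR oppr_le0.
      rewrite (ger0_norm (_ : 0 <= 1 - _)) ?subr_ge0//.
      rewrite [leRHS]mulrC ler_wpM2l ?subr_ge0//.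
      by apply: hp; rewrite expR_ge0.
    apply/andP; split.
      apply: E_le; [|exact: goodB|].
        by apply: goodM; [exact: good_cst|apply: goodM => //; exact: good_cst].
      by move=> z /key; rewrite ler_norml mulN1r => /andP[].
    apply: E_le; [exact: goodB| |].
      by apply: goodM => //; exact: good_cst.
    by move=> z /key; rewrite ler_norml => /andP[].
  rewrite E_Z// mulrCA (le_trans (ler_wpM2l (ltW eC0) (hC n)))//.
  by rewrite le_eqVlt; apply/orP; left; apply/eqP; field; rewrite lt0r_neq0.
exists (limn v).
have /cvgrPdist_lt/(_ _ (divr_gt0 e0 (ltr0Sn R 1))) := cp.
apply: filterS => n hn.
rewrite /ball/= (le_lt_trans (ler_distD (v n) _ _))// [ltRHS]splitr.
by rewrite ltr_leD// distrC uv.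
Qed.

Definition lim_truncated_mean x := limn (truncated_mean ^~ x).

Lemma cvg_truncated_mean x : 0 < x ->
  truncated_mean ^~ x @ \oo --> lim_truncated_mean x.
Proof. exact: is_cvg_truncated_mean. Qed.

Let good_gt a : good (fun z => \1_[set z | a < z] z).
Proof.
split; first by apply: measurable_indic; rewrite -set_itvoy; exact: measurable_itv.
by exists 1 => z _; rewrite indicE; case: (_ \in _); rewrite ?normr0 ?normr1.
Qed.

Let E_gt n a : E n (fun z => \1_[set z | a < z] z) = fine (P [set w | a < Z n w]).
Proof.
have mA : measurable [set w | a < Z n w].
  have := mZ n measurableT (measurable_itv `]a, +oo[).
  congr measurable; apply/seteqP; split => w /=; rewrite in_itv/= andbT.
    by case.
  by [].
rewrite /E /Rintegral -[X in _ = fine (P X)]setIT -integral_indic//.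
Qed.

(** Pointwise, [min(z, y) - min(z, x)] equals [y - x] if [z > y], vanishes if [z <= x], and lies
    between these values otherwise. *)
Lemma truncated_mean_slope n x y : 0 < x -> x < y ->
  (y - x) * (c n * fine (P [set w | y < Z n w])) <=
    truncated_mean n y - truncated_mean n x <=
  (y - x) * (c n * fine (P [set w | x < Z n w])).
Proof.
move=> x0 xy; have y0 := lt_trans x0 xy.
have gx := good_min x0; have gy := good_min y0.
have g1y := goodM (good_cst (y - x)) (good_gt y).
have g1x := goodM (good_cst (y - x)) (good_gt x).
rewrite /truncated_mean -/(E n (fun z => Num.min z x)).
rewrite -/(E n (fun z => Num.min z y)) -mulrBr -E_B// -!E_gt.
rewrite !(mulrCA (y - x)) -(E_Z _ _ (good_gt y)) -(E_Z _ _ (good_gt x)).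
rewrite !ler_wpM2l//.
  apply: E_le => //; first exact: goodB.
  move=> z z0; rewrite indicE.
  have [zx|xz] := boolP (z \in _); rewrite ?mulr1 ?mulr0.
    move: zx; rewrite inE/= => xz.
    by rewrite (min_r (ltW xz)) lerD2r ge_min lexx orbT.
  move: xz; rewrite notin_setE/= => /negP; rewrite -leNgt => zx.
  by rewrite (min_l zx) (min_l (le_trans zx (ltW xy))) subrr.
apply: E_le => //; first exact: goodB.
move=> z z0; rewrite indicE.
have [zy|yz] := boolP (z \in _); rewrite ?mulr1 ?mulr0.
  move: zy; rewrite inE/= => /ltW yz.
  by rewrite !min_r// (le_trans (ltW xy)).
by rewrite subr_ge0 le_min ge_min lexx/= ge_min (ltW xy) orbT.
Qed.

End truncated_mean.

(** * Laplace transforms *)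

Section laplace_integrals.
Context {R : realType}.
Notation mu := (@lebesgue_measure R).
Implicit Types (s x y z : R).

Let cexp s : continuous (fun y : R => expR (- (s * y))).
Proof.
move=> y; apply: continuous_comp; last exact: continuous_expR.
by apply: cvgN; apply: cvgM; [exact: cvg_cst|exact: cvg_id].
Qed.

Let dexp s y : is_derive y 1 (fun y : R => expR (- (s * y))) (- s * expR (- (s * y))).
Proof.
have -> : (fun y : R => expR (- (s * y))) = expR \o (fun y => (- s) * y).
  by apply/funext => t /=; rewrite mulNr.
have H : is_derive y 1 (fun t : R => - s * t) (- s).
  have := @is_deriveZ R R^o R^o (fun t => t) (- s) y 1 1 (is_derive_id y 1).
  by rewrite /GRing.scale/= mulr1.
apply: is_derive_eq (is_derive1_comp (is_derive_expR _) H) _.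
by rewrite mulNr mulrC.
Qed.

Let cvgy_exp s : 0 < s -> expR (- (s * y)) @[y --> +oo] --> (0 : R).
Proof.
move=> s0.
apply: (@cvg_comp _ _ _ (fun y => s * y) (fun y => expR (- y)) _ (pinfty_nbhs R)).
  exact: gt0_cvgMry.
exact: cvgr_expR.
Qed.

Lemma integral_expR_itvy s x : 0 < s ->
  (\int[mu]_(y in `[x, +oo[) (s * expR (- (s * y)))%:E = (expR (- (s * x)))%:E)%E.
Proof.
move=> s0.
rewrite (@ge0_continuous_FTC2y _ _ (fun y => - expR (- (s * y))) x 0).
- by rewrite -EFinN opprK -EFinD add0r.
- by move=> y _; rewrite mulr_ge0 ?expR_ge0// ltW.
- apply: continuous_subspaceT => y.
  by apply: cvgM; [exact: cvg_cst|exact: cexp].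
- by rewrite -oppr0; apply: cvgN; exact: cvgy_exp.
- by move=> y _; apply: derivableN; case: (dexp s y).
- by apply: cvgN; apply: cvg_at_right_filter; exact: cexp.
- move=> y _; have [d e] := dexp s y.
  by rewrite derive1E deriveN// e mulNr opprK.
Qed.

Lemma measurable_expRM s (D : set R) : measurable_fun D (fun y : R => expR (- (s * y))).
Proof. by apply: measurable_funTS; apply: continuous_measurable_fun; exact: cexp. Qed.

Lemma integrable_expR s : 0 < s ->
  mu.-integrable `]0, +oo[ (fun y => (expR (- (s * y)))%:E).
Proof.
move=> s0; apply/integrableP; split.
  by apply/measurable_EFinP; exact: measurable_expRM.
under eq_integral do rewrite gee0_abs ?lee_fin ?expR_ge0//.
rewrite integral_itv_obnd_cbnd; last by apply/measurable_EFinP; exact: measurable_expRM.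
have -> : (fun y => (expR (- (s * y)))%:E) =
    (fun y => (s^-1)%:E * (s * expR (- (s * y)))%:E)%E.
  by apply/funext => y; rewrite -EFinM mulrA mulVf ?gt_eqF// mul1r.
rewrite ge0_integralZl//.
- by rewrite integral_expR_itvy// -EFinM ltry.
- by apply/measurable_EFinP; apply: measurable_funM => //; exact: measurable_expRM.
- by move=> y _; rewrite lee_fin mulr_ge0 ?expR_ge0// ltW.
- by rewrite lee_fin invr_ge0 ltW.
Qed.

(** One half of the exponential absorbs the affine growth, since [1 + s y / 2 <= exp(s y / 2)]; the
    other half remains as an integrable bound. *)
Lemma affine_expR_le s y : 0 < s -> 0 <= y ->
  (1 + y) * expR (- (s * y)) <= (1 + 2 / s) * expR (- (s / 2 * y)).
Proof.
move=> s0 y0; rewrite (_ : - (s * y) = - (s / 2 * y) + - (s / 2 * y)); last by field.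
rewrite expRD mulrA ler_wpM2r ?expR_ge0//.
rewrite expRN ler_pdivrMr ?expR_gt0//.
apply: le_trans (ler_wpM2l _ (expR_ge1Dx (s / 2 * y))); last first.
  by rewrite addr_ge0// divr_ge0// ltW.
have -> : (1 + 2 / s) * (1 + s / 2 * y) = 1 + y + (2 / s + s / 2 * y).
  by field; rewrite gt_eqF.
have i0 : 0 <= s^-1 by rewrite invr_ge0 ltW.
by rewrite lerDl addr_ge0// !mulr_ge0// ltW.
Qed.

(** Dominated convergence under affine growth. Applied to a constant sequence, the first conclusion
    serves as an integrability criterion. *)
Lemma cvg_laplace_integral (f_ : nat -> R -> R) (f : R -> R) (C s : R) :
  0 < s ->
  (forall n, measurable_fun (`]0, +oo[ : set R) (f_ n)) ->
  (forall y, 0 < y -> f_ ^~ y @ \oo --> f y) ->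
  (forall n y, 0 < y -> `|f_ n y| <= C * (1 + y)) ->
  [/\ mu.-integrable `]0, +oo[ (fun y => (expR (- (s * y)) * f y)%:E) &
  (\int[mu]_(y in `]0%R, +oo[) (expR (- (s * y)) * f_ n y)%:E)%E @[n --> \oo] -->
  (\int[mu]_(y in `]0%R, +oo[) (expR (- (s * y)) * f y)%:E)%E].
Proof.
move=> s0 mf_ f_f f_C.
have C0 : 0 <= C.
  have := le_trans (normr_ge0 _) (f_C 0%N 1 ltr01).
  by rewrite pmulr_lge0// addr_gt0.
have mf : measurable_fun (`]0, +oo[ : set R) f.
  apply: measurable_fun_cvg mf_ _ => y /=; rewrite in_itv/= andbT; exact: f_f.
have mexpM (g : R -> R) : measurable_fun (`]0, +oo[ : set R) g ->
    measurable_fun (`]0, +oo[ : set R) (fun y => expR (- (s * y)) * g y).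
  by move=> mg; apply: measurable_funM => //; exact: measurable_expRM.
have [] := @dominated_convergence _ _ R mu `]0, +oo[%classic
   _ (fun n y => (expR (- (s * y)) * f_ n y)%:E)
   (fun y => (expR (- (s * y)) * f y)%:E)
   (fun y => ((C * (1 + 2 / s)) * expR (- (s / 2 * y)))%:E).
- exact: measurable_itv.
- by move=> n; apply/measurable_EFinP; exact: mexpM.
- by apply/measurable_EFinP; exact: mexpM.
- apply: aeW => y /=; rewrite in_itv/= andbT => y0.
  apply: cvg_EFin; first exact: nearW.
  by apply: cvgM; [exact: cvg_cst|exact: f_f].
- have s20 : 0 < s / 2 by rewrite divr_gt0.
  exact: (@integrableZl _ _ _ mu _ (measurable_itv _) (C * (1 + 2 / s)) _
    (integrable_expR s20)).
- apply: aeW => y n /=; rewrite in_itv/= andbT => y0.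
  rewrite lee_fin normrM ger0_norm ?expR_ge0//.
  rewrite (le_trans (ler_wpM2l (expR_ge0 _) (f_C n y y0)))//.
  rewrite mulrCA -mulrA ler_wpM2l// mulrC.
  exact: affine_expR_le (ltW y0).
by move=> h1 _ h2; split.
Qed.

Lemma integral_expR_min s z : 0 < s -> 0 <= z ->
  (\int[mu]_(y in `]0%R, +oo[) (expR (- (s * y)) * Num.min z y)%:E =
   ((1 - expR (- (s * z))) / s ^+ 2)%:E)%E.
Proof.
move=> s0; rewrite le_eqVlt => /predU1P[<-|z0].
  rewrite mulr0 oppr0 expR0 subrr mul0r integral0_eq// => y.
  by rewrite /= in_itv/= andbT => y0; rewrite (min_idPl (ltW y0)) mulr0.
have cm : continuous (fun y => expR (- (s * y)) * Num.min z y).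
  move=> y; apply: cvgM; first exact: cexp.
  by apply: continuous_min; [exact: cvg_cst|exact: cvg_id].
have mm (D : set R) : measurable_fun D
    (EFin \o (fun y => expR (- (s * y)) * Num.min z y)).
  by apply/measurable_EFinP; apply: measurable_funTS; exact: continuous_measurable_fun.
rewrite integral_itv_obnd_cbnd//.
rewrite (@itv_bndbnd_setU _ _ _ (BLeft z)) ?bnd_simp ?ltW//.
rewrite ge0_integral_setU//=; last 3 first.
- exact: mm.
- move=> y yz; have y0 : 0 <= y.
    case: yz => /=; rewrite in_itv/=; first by case/andP.
    by rewrite andbT; apply: le_trans; exact: ltW.
  by rewrite lee_fin mulr_ge0 ?expR_ge0// le_min y0 ltW.
- apply/disj_setPS => y [/=]; rewrite !in_itv/= andbT => /andP[_ yz].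
  by rewrite leNgt yz.
rewrite integral_itv_bndo_bndc//.
have -> : (\int[mu]_(y in `[0%R, z]) (expR (- (s * y)) * Num.min z y)%:E =
    \int[mu]_(y in `[0%R, z]) (y * expR (- (s * y)))%:E)%E.
  apply: eq_integral => y; rewrite inE/= in_itv/= => /andP[_ yz].
  by rewrite (min_idPr yz) mulrC.
have -> : (\int[mu]_(y in `[z, +oo[) (expR (- (s * y)) * Num.min z y)%:E =
    \int[mu]_(y in `[z, +oo[) ((z / s)%:E * (s * expR (- (s * y)))%:E))%E.
  apply: eq_integral => y; rewrite inE/= in_itv/= andbT => zy.
  rewrite (min_idPl zy) -EFinM; congr EFin; field.
  by rewrite gt_eqF.
rewrite ge0_integralZl//; last 3 first.
- by apply/measurable_EFinP; apply: measurable_funM => //; exact: measurable_expRM.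
- by move=> y _; rewrite lee_fin mulr_ge0 ?expR_ge0// ltW.
- by rewrite lee_fin divr_ge0// ltW.
rewrite integral_expR_itvy//.
pose F y := - ((y / s + s ^- 2) * expR (- (s * y))).
have cF : continuous F.
  move=> y; apply: cvgN; apply: cvgM; last exact: cexp.
  apply: cvgD; last exact: cvg_cst.
  by apply: cvgM; [exact: cvg_id|exact: cvg_cst].
have dF y : is_derive y 1 F (y * expR (- (s * y))).
  have := dexp s y => d.
  apply: is_derive_eq.
  rewrite /GRing.scale/=; field.
  by rewrite gt_eqF.
rewrite (@continuous_FTC2 _ _ F)//.
- rewrite -EFinM -!EFinB -EFinD /F mulr0 oppr0 expR0; congr EFin; field.
  by rewrite gt_eqF.
- apply: continuous_subspaceT => y.
  by apply: cvgM; [exact: cvg_id|exact: cexp].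
- split.
  + by move=> y _; exact: ex_derive.
  + by apply: cvg_at_right_filter; exact: cF.
  + by apply: cvg_at_left_filter; exact: cF.
- by move=> y _; rewrite derive1E; exact: derive_val.
Qed.

End laplace_integrals.

(** * Laplace transforms of truncated means and of Stieltjes measures *)

Section tonelli.
Context {R : realType}.
Notation mu := (@lebesgue_measure R).

Lemma laplace_integral_truncated d (T : measurableType d) (P : probability T R)
    (Z : T -> R) (s : R) :
  measurable_fun setT Z -> (forall w, 0 <= Z w) -> 0 < s ->
  (\int[mu]_(y in `]0%R, +oo[) (expR (- (s * y)) * \int[P]_w Num.min (Z w) y)%:E =
   (\int[P]_w (1 - expR (- (s * Z w))) / s ^+ 2)%:E)%E.
Proof.
move=> mZ Z0 s0.
(* The indicator extends the integrand by 0 to negative [y], where [min(Z, y)] would be negative and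
   Tonelli would not apply. *)
pose f (wy : T * measurableTypeR R) : \bar R :=
  (expR (- (s * wy.2)) * Num.min (Z wy.1) wy.2 * \1_(`]0%R, +oo[ : set R) wy.2)%:E.
have f0 wy : (0 <= f wy)%E.
  rewrite /f lee_fin indicE; have [|] := boolP (_ \in _); rewrite ?mulr0// mulr1.
  rewrite inE/= in_itv/= andbT => y0.
  by rewrite mulr_ge0 ?expR_ge0// le_min Z0 ltW.
have m2 (g : R -> R) : measurable_fun setT g ->
    measurable_fun setT (fun wy : T * measurableTypeR R => g wy.2).
  by move=> mg; exact: measurableT_comp.
have mexp : measurable_fun setT (fun y : R => expR (- (s * y))).
  exact: measurable_expRM.
have mf : measurable_fun setT f.
  have mmin : measurable_fun setT
      (fun wy : T * measurableTypeR R => Num.min (Z wy.1) (wy.2 : R)).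
    by apply: measurable_minr; [exact: measurableT_comp|exact: (m2 id)].
  have mi : measurable_fun setT (\1_(`]0%R, +oo[ : set R) : R -> R).
    exact: measurable_indic.
  have m0 := m2 _ mi.
  have H := measurable_funM (measurable_funM (m2 _ mexp) mmin) m0.
  apply/measurable_EFinP; exact: H.
have iexp : P.-integrable setT (EFin \o (fun w => 1 - expR (- (s * Z w)))).
  apply: (@integrable_le_cst _ _ _ _ _ _ 1) => //.
  - by rewrite /= probability_setT ltry.
  - by apply: measurable_funB => //; exact: measurableT_comp mexp mZ.
  - move=> w _; have e0 := expR_ge0 (- (s * Z w)).
    have e1 : expR (- (s * Z w)) <= 1.
      by rewrite -expR0 ler_expR oppr_le0 mulr_ge0// ltW.
    by rewrite ger0_norm ?subr_ge0// lerBlDr lerDl.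
have := fubini_tonelli (m1 := P) (m2 := mu) f mf f0.
have -> : (\int[P]_w \int[mu]_y f (w, y) =
    (\int[P]_w (1 - expR (- (s * Z w))) / s ^+ 2)%:E)%E.
  transitivity (\int[P]_w ((s ^- 2)%:E * (1 - expR (- (s * Z w)))%:E))%E.
    apply: eq_integral => w _.
    rewrite -EFinM mulrC -(integral_expR_min s0 (Z0 w)) [RHS]integral_mkcond.
    apply: eq_integral => y _; rewrite patchE /f/= indicE.
    by case: (_ \in _); rewrite ?mulr1 ?mulr0.
  rewrite integralZl// [X in _ = X%:E]mulrC EFinM; congr (_ * _)%E.
  by rewrite /Rintegral fineK//; exact: integrable_fin_num iexp.
move=> ->; rewrite integral_mkcond.
apply: eq_integral => y _; rewrite patchE /f/= indicE.
have [|_] := boolP (y \in _); last first.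
  by under eq_integral do rewrite mulr0; rewrite integral0.
rewrite inE/= in_itv/= andbT => y0.
under [RHS]eq_integral do rewrite mulr1 EFinM.
have imin : P.-integrable setT (EFin \o (fun w => Num.min (Z w) y)).
  apply: (@integrable_le_cst _ _ _ _ _ _ y) => //.
  - by rewrite /= probability_setT ltry.
  - exact: measurable_minr.
  - by move=> w _; rewrite ger0_norm ?ge_min ?lexx ?orbT// le_min Z0 ltW.
rewrite integralZl// EFinM; congr (_ * _)%E.
by rewrite /Rintegral fineK//; exact: integrable_fin_num imin.
Qed.

Lemma lebesgue_stieltjes_itvoc (G : cumulative R R) (a b : R) : a <= b ->
  lebesgue_stieltjes_measure G `]a, b] = (G b - G a)%:E.
Proof.
move=> ab; rewrite /lebesgue_stieltjes_measure /measure_extension/=.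
rewrite measurable_mu_extE/= ?wlength_itv_bnd//; exact: is_ocitv.
Qed.

(** Integration by parts without boundary terms: [exp(- s x)] is the integral of [s exp(- s y)] over
    [y >= x], and exchanging the integrals leaves the mass [G y] of []0, y]]. It turns [opA] into an
    ordinary Laplace transform. *)
Lemma laplace_stieltjes (G : cumulative R R) (s : R) :
  0 < s -> G 0 = 0 ->
  (\int[lebesgue_stieltjes_measure G]_(x in `]0%R, +oo[) (expR (- (s * x)))%:E =
   s%:E * \int[mu]_(y in `]0%R, +oo[) (expR (- (s * y)) * G y)%:E)%E.
Proof.
move=> s0 G0; set nu := lebesgue_stieltjes_measure G.
(* The condition [x <= y] is encoded as an indicator of the difference [y - x], so that joint
   measurability is a composition. *)
pose f (xy : measurableTypeR R * measurableTypeR R) : \bar R :=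
  (s * expR (- (s * xy.2)) *
   (\1_(`]0%R, +oo[ : set R) xy.1 * \1_(`[0%R, +oo[ : set R) (xy.2 - xy.1)))%:E.
have f0 xy : (0 <= f xy)%E.
  by rewrite /f lee_fin !mulr_ge0 ?expR_ge0// ltW.
have m1 (g : R -> R) : measurable_fun setT g ->
    measurable_fun setT (fun xy : measurableTypeR R * measurableTypeR R => g xy.1).
  by move=> mg; exact: measurableT_comp.
have m2 (g : R -> R) : measurable_fun setT g ->
    measurable_fun setT (fun xy : measurableTypeR R * measurableTypeR R => g xy.2).
  by move=> mg; exact: measurableT_comp.
have mexp : measurable_fun setT (fun y : R => expR (- (s * y))).
  exact: measurable_expRM.
have mf : measurable_fun setT f.
  pose J : R -> R := \1_(`[0%R, +oo[ : set R).
  have mJ : measurable_fun setT J by exact: measurable_indic.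
  have mB : measurable_fun setT (fun xy : measurableTypeR R * measurableTypeR R =>
      (xy.2 : R) - (xy.1 : R)).
    by apply: measurable_funB; [exact: (m2 id)|exact: (m1 id)].
  have msub := measurableT_comp mJ mB.
  have mi : measurable_fun setT (\1_(`]0%R, +oo[ : set R) : R -> R).
    exact: measurable_indic.
  have mind := m1 _ mi.
  have ms := m2 _ (measurable_funM (measurable_cst s) mexp).
  have H := measurable_funM ms (measurable_funM mind msub).
  apply/measurable_EFinP; exact: H.
have := fubini_tonelli (m1 := nu) (m2 := mu) f mf f0.
have -> : (\int[nu]_x \int[mu]_y f (x, y) =
    \int[nu]_(x in `]0%R, +oo[) (expR (- (s * x)))%:E)%E.
  rewrite [RHS]integral_mkcond; apply: eq_integral => x _.
  rewrite patchE /f/=; have [x0|x0] := boolP (x \in _); last first.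
    rewrite indicE (negbTE x0).
    by under eq_integral do rewrite mul0r mulr0; rewrite integral0.
  rewrite -(integral_expR_itvy x s0) [RHS]integral_mkcond.
  apply: eq_integral => y _; rewrite patchE indicE x0 mul1r indicE.
  rewrite (_ : (y - x \in `[0, +oo[%classic) = (y \in `[x, +oo[%classic)).
    by case: (_ \in _); rewrite ?mulr1 ?mulr0.
  by apply/idP/idP; rewrite !inE/= !in_itv/= !andbT subr_ge0.
move=> ->.
have mG : measurable_fun setT (fun y : R => expR (- (s * y)) * G y).
  apply: measurable_funM => //; apply: nondecreasing_measurable => //.
  exact: cumulative_is_nondecreasing.
rewrite -ge0_integralZl//; last 3 first.
- by apply/measurable_EFinP; exact: measurable_funTS.
- move=> y /=; rewrite in_itv/= andbT => y0.
  rewrite lee_fin mulr_ge0 ?expR_ge0// -G0.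
  by apply: cumulative_is_nondecreasing; exact: ltW.
- by rewrite lee_fin ltW.
rewrite [RHS]integral_mkcond; apply: eq_integral => y _.
rewrite patchE mem_setE in_itv/= andbT; have [y0|y0] := ltP 0 y.
  transitivity (\int[nu]_(x in `]0%R, y]) (s * expR (- (s * y)))%:E)%E.
    rewrite [RHS]integral_mkcond; apply: eq_integral => x _.
    rewrite patchE /f/= !indicE -natrM mulnb.
    rewrite !mem_setE !in_itv/= !andbT subr_ge0.
    by case: (_ && _); rewrite ?mulr1 ?mulr0.
  rewrite integral_cst// -EFinM mulrA EFinM; congr (_ * _)%E.
  by have /= := lebesgue_stieltjes_itvoc G (ltW y0); rewrite G0 subr0.
apply: integral0_eq => x _.
rewrite /f/= !indicE -natrM mulnb.
rewrite !mem_setE !in_itv/= !andbT subr_ge0.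
rewrite (_ : (_ && _) = false) ?mulr0//; apply/negP => /andP[x0 xy].
by have := lt_le_trans x0 (le_trans xy y0); rewrite ltxx.
Qed.

End tonelli.

(** * Injectivity of the Laplace transform *)

Section laplace_injectivity.
Context {R : realType}.
Notation mu := (@lebesgue_measure R).
Implicit Types (D Q : R -> R) (C y : R).

Let integrable_expM D C (s : R) : 0 < s ->
  measurable_fun (`]0, +oo[ : set R) D ->
  (forall y, 0 < y -> `|D y| <= C * (1 + y)) ->
  mu.-integrable `]0, +oo[ (EFin \o (fun y => expR (- (s * y)) * D y)).
Proof.
move=> s0 mD DC.
by have [] := @cvg_laplace_integral R (fun=> D) D C s s0 (fun=> mD)
  (fun _ _ => cvg_cst _) (fun=> DC).
Qed.

Let mexp1 : measurable_fun (`]0, +oo[ : set R) (fun y : R => expR (- y)).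
Proof.
by apply: measurableT_comp => //; apply: measurableT_comp => //; exact: measurable_id.
Qed.

Let expR_itv01 y : 0 < y -> 0 <= expR (- y) <= 1.
Proof.
by move=> y0; rewrite expR_ge0/= -expR0 ler_expR oppr_le0 ltW.
Qed.

(** In the variable [exp(- y)], transforms at the positive integers are moments, so their vanishing
    extends to polynomials by linearity. At least one exponential factor is always kept, since [D]
    itself need not be integrable. *)
Let integral_poly D C (p : {poly R}) k :
  measurable_fun (`]0, +oo[ : set R) D ->
  (forall y, 0 < y -> `|D y| <= C * (1 + y)) ->
  (forall k : nat,
    \int[mu]_(y in `]0, +oo[) (expR (- (k.+1%:R * y)) * D y) = 0) ->
  mu.-integrable `]0, +oo[
    (EFin \o (fun y => expR (- (k.+1%:R * y)) * p.[expR (- y)] * D y)) /\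
  \int[mu]_(y in `]0, +oo[) (expR (- (k.+1%:R * y)) * p.[expR (- y)] * D y) = 0.
Proof.
move=> mD DC D0; elim/poly_ind: p k => [|p a IH] k.
  rewrite (_ : (fun y => _) = fun=> 0); last first.
    by apply/funext => y; rewrite horner0 mulr0 mul0r.
  split; last by rewrite Rintegral_cst// mul0r.
  exact: integrable0.
have [i1 e1] := IH k.+1.
have i2 : mu.-integrable `]0, +oo[ (EFin \o (fun y => expR (- (k.+1%:R * y)) * D y)).
  by apply: (@integrable_expM D C); rewrite ?ltr0n.
have i3 : mu.-integrable `]0, +oo[
    (EFin \o (fun y => a * (expR (- (k.+1%:R * y)) * D y))).
  exact: (@integrableZl _ _ _ mu _ (measurable_itv _) a _ i2).
rewrite (_ : (fun y => _) = fun y =>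
  expR (- (k.+2%:R * y)) * p.[expR (- y)] * D y +
  a * (expR (- (k.+1%:R * y)) * D y)); last first.
  apply/funext => y; rewrite hornerD hornerM hornerX hornerC.
  by rewrite -!mulrN !expRM_natl [_ ^+ k.+2]exprS; ring.
split.
  exact: (@integrableD _ _ _ mu _ (measurable_itv _) _ _ i1 i3).
by rewrite RintegralD// RintegralZl// e1 D0 mulr0 addr0.
Qed.

Let integral_continuous D C (g : R -> R) :
  measurable_fun (`]0, +oo[ : set R) D ->
  (forall y, 0 < y -> `|D y| <= C * (1 + y)) ->
  (forall k : nat,
    \int[mu]_(y in `]0, +oo[) (expR (- (k.+1%:R * y)) * D y) = 0) ->
  continuous g ->
  mu.-integrable `]0, +oo[
    (EFin \o (fun y => expR (- (1 * y)) * (g (expR (- y)) * D y))) /\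
  \int[mu]_(y in `]0, +oo[) (expR (- (1 * y)) * (g (expR (- y)) * D y)) = 0.
Proof.
move=> mD DC D0 cg.
have mg : measurable_fun (`]0, +oo[ : set R) (fun y => g (expR (- y))).
  by apply: (@measurableT_comp _ _ _ _ _ _ g) => //; exact: continuous_measurable_fun.
have bnd (h : R -> R) (M : R) : 0 <= M ->
    (forall t, 0 <= t <= 1 -> `|h t| <= M) ->
    forall y, 0 < y -> `|h (expR (- y)) * D y| <= M * C * (1 + y).
  move=> M0 hM y y0; rewrite normrM -mulrA ler_pM// ?DC//.
  by apply: hM; exact: expR_itv01.
have ibnd (h : R -> R) (M : R) : 0 <= M ->
    measurable_fun (`]0, +oo[ : set R) (fun y => h (expR (- y))) ->
    (forall t, 0 <= t <= 1 -> `|h t| <= M) ->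
  mu.-integrable `]0, +oo[
    (EFin \o (fun y => expR (- (1 * y)) * (h (expR (- y)) * D y))).
  move=> M0 mh hM; apply: (@integrable_expM _ (M * C)) => //.
    exact: measurable_funM.
  exact: bnd.
have bounded_g : exists2 M, 0 <= M & forall t, 0 <= t <= 1 -> `|g t| <= M.
  have cgn : {within `[0, 1], continuous (fun t => `|g t|)}.
    apply: continuous_subspaceT => t.
    by apply: continuous_comp; [exact: cg|exact: norm_continuous].
  have [a _ ha] := EVT_max (@ler01 R) cgn.
  by exists `|g a| => // t t01; apply: ha; rewrite in_itv.
have [M M0 hM] := bounded_g.
have ig := ibnd _ _ M0 mg hM.
split => //.
have iD : mu.-integrable `]0, +oo[ (EFin \o (fun y => expR (- (1 * y)) * `|D y|)).
  apply: (@integrable_expM _ C) => //; first exact: measurableT_comp.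
  by move=> y y0; rewrite normr_id DC.
pose I := \int[mu]_(y in `]0, +oo[) (expR (- (1 * y)) * `|D y|).
have I0 : 0 <= I by apply: Rintegral_ge0 => y _; rewrite mulr_ge0 ?expR_ge0.
apply/eqP; rewrite -normr_le0; apply/ler_addgt0Pr => e e0; rewrite add0r.
(* The approximation error is integrated against the mass [I], which may be 0; dividing by [1 + I]
   still leaves at most [e]. *)
have e10 : 0 < e / (1 + I) by rewrite divr_gt0// ltr_wpDr.
have [p hp] := weierstrass_approximation (continuous_subspaceT cg) e10.
have [ip p0] := integral_poly p 0 mD DC D0.
have ip' : mu.-integrable `]0, +oo[
    (EFin \o (fun y => expR (- (1 * y)) * (p.[expR (- y)] * D y))).
  by move: ip; congr (_.-integrable _ _); apply/funext => y /=; rewrite mulrA.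
have -> : \int[mu]_(y in `]0, +oo[) (expR (- (1 * y)) * (g (expR (- y)) * D y)) =
  \int[mu]_(y in `]0, +oo[) (expR (- (1 * y)) * (g (expR (- y)) * D y) -
     expR (- (1 * y)) * (p.[expR (- y)] * D y)).
  rewrite RintegralB//; move: p0; under eq_Rintegral do rewrite -mulrA.
  by move=> ->; rewrite subr0.
rewrite (le_trans (le_normr_Rintegral _ _))//.
  exact: (@integrableB _ _ _ mu _ (measurable_itv _) _ _ ig ip').
have ie : mu.-integrable `]0, +oo[
    (EFin \o (fun y => e / (1 + I) * (expR (- (1 * y)) * `|D y|))).
  exact: (@integrableZl _ _ _ mu _ (measurable_itv _) (e / (1 + I)) _ iD).
apply: (@le_trans _ _ (\int[mu]_(y in `]0, +oo[)
    (e / (1 + I) * (expR (- (1 * y)) * `|D y|)))).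
  apply: le_Rintegral => //.
    exact: (integrable_norm (@integrableB _ _ _ mu _ (measurable_itv _) _ _ ig ip')).
  move=> y; rewrite /= in_itv/= andbT => y0.
  rewrite -mulrBr -mulrBl !normrM (ger0_norm (expR_ge0 _)) mulrCA.
  by rewrite ler_wpM2r ?mulr_ge0 ?expR_ge0// hp// expR_itv01.
rewrite RintegralZl// -/I mulrAC ler_pdivrMr ?ltr_wpDr//.
by rewrite ler_wpM2l ?(ltW e0)// lerDr.
Qed.

(** If [D y] were positive, a continuous test function of [exp(- y)] supported where [D] is positive
    would give a strictly positive integral. One sign suffices, as the result is applied to a
    difference in both orders. *)
Let integral_eq0_le D C y : (forall y, 0 < y -> {for y, continuous D}) ->
  (forall y, 0 < y -> `|D y| <= C * (1 + y)) ->
  (forall k : nat,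
    \int[mu]_(y in `]0, +oo[) (expR (- (k.+1%:R * y)) * D y) = 0) ->
  0 < y -> D y <= 0.
Proof.
move=> cD DC D0 y0; rewrite leNgt; apply/negP => Dy.
have mD : measurable_fun (`]0, +oo[ : set R) D.
  apply: open_continuous_measurable_fun => // t.
  by rewrite inE/= in_itv/= andbT; exact: cD.
pose t0 := expR (- y).
have [e /= e0 he] : \forall t \near t0, 0 < D (- ln t).
  have : (D \o (fun t => - ln t)) t @[t --> t0] --> (D \o (fun t => - ln t)) t0.
    apply: continuous_comp.
      by apply: cvgN; apply: continuous_ln; rewrite expR_gt0.
    by apply: cD; rewrite /t0 expRK opprK.
  move=> /cvgr_gt; apply.
  by rewrite /= /t0 expRK opprK.
(* A tent around [exp(- y)] whose support is the ball of radius [e] on which [D (- ln t)] is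
   positive. *)
pose g (t : R) := Num.max 0 (e - `|t0 - t|).
have cg : continuous g.
  move=> t; apply: (@continuous_max R R^o (fun=> 0) (fun t => e - `|t0 - t|) t).
    exact: cvg_cst.
  apply: cvgB; first exact: cvg_cst.
  apply: cvg_norm; apply: cvgB; first exact: cvg_cst.
  exact: cvg_id.
have [ig g0] := integral_continuous mD DC D0 cg.
pose f (y : R) := expR (- (1 * y)) * (g (expR (- y)) * D y).
have f0 z : 0 < z -> 0 <= f z.
  move=> z0; rewrite /f mulr_ge0 ?expR_ge0//.
  rewrite /g; case: (leP 0 (e - _)) => h; last by rewrite mul0r.
  move: h; rewrite subr_ge0 le_eqVlt => /predU1P[->|h].
    by rewrite subrr mul0r.
  rewrite mulr_ge0 ?subr_ge0 ?(ltW h)// ltW//.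
  by have := he _ h; rewrite expRK opprK.
have cf : {for y, continuous f}.
  have ce : {for y, continuous (fun y : R => expR (- y))}.
    by apply: continuous_comp; [apply: cvgN; exact: cvg_id|exact: continuous_expR].
  apply: cvgM.
    by under eq_fun do rewrite mul1r; rewrite mul1r; exact: ce.
  apply: cvgM; last exact: cD.
  by apply: (@cvg_comp _ _ _ (fun y => expR (- y)) g _ _ _ ce); exact: cg.
have fy : 0 < f y.
  rewrite /f mulr_gt0 ?expR_gt0// mulr_gt0// /g /t0 subrr normr0 subr0.
  by rewrite lt_max e0 orbT.
have [dl /= dl0 hdl] : \forall z \near y, f y / 2 < f z.
  have : f z @[z --> y] --> f y by exact: cf.
  move=> /cvgr_gt; apply.
  by rewrite ltr_pdivrMr// ltr_pMr// ltr1n.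
have mf : measurable_fun (`]0, +oo[ : set R) (EFin \o f).
  by have /integrableP[] := ig.
have sub : (`[y, y + dl / 2] : set R) `<=` `]0, +oo[.
  by move=> z /=; rewrite !in_itv/= andbT => /andP[/(lt_le_trans y0)].
have If0 : (\int[mu]_(z in `]0%R, +oo[) (f z)%:E = 0)%E.
  by rewrite -[LHS]fineK ?integrable_fin_num//; congr EFin.
have : (\int[mu]_(z in `[y, (y + dl / 2)%R]) (f z)%:E <= 0)%E.
  rewrite -If0; apply: ge0_subset_integral => //.
  by move=> z; rewrite /= in_itv/= andbT lee_fin => /f0.
apply/negP; rewrite -ltNge.
apply: (@lt_le_trans _ _ (\int[mu]_(z in `[y, (y + dl / 2)%R]) (f y / 2)%:E)%E).
  rewrite integral_cst//= lebesgue_measure_itv/= lte_fin ltrDl divr_gt0//.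
  by rewrite -EFinB addrAC subrr add0r -EFinM lte_fin mulr_gt0// divr_gt0.
apply: ge0_le_integral => //.
- by move=> z _; rewrite lee_fin divr_ge0// ltW.
- by apply: measurable_funS mf => //.
- move=> z /=; rewrite in_itv/= => /andP[yz zy]; rewrite lee_fin ltW// hdl//=.
  rewrite ler0_norm ?subr_le0// opprB ltrBlDl (le_lt_trans zy)// ltrD2l.
  by rewrite ltr_pdivrMr// ltr_pMr// ltr1n.
Qed.

Lemma laplace_injective Q1 Q2 C y :
  (forall y, 0 < y -> {for y, continuous Q1}) ->
  (forall y, 0 < y -> {for y, continuous Q2}) ->
  (forall y, 0 < y -> `|Q1 y| <= C * (1 + y)) ->
  (forall y, 0 < y -> `|Q2 y| <= C * (1 + y)) ->
  (forall s : R, 0 < s ->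
    (\int[mu]_(y in `]0%R, +oo[) (expR (- (s * y)) * Q1 y)%:E =
     \int[mu]_(y in `]0%R, +oo[) (expR (- (s * y)) * Q2 y)%:E)%E) ->
  0 < y -> Q1 y = Q2 y.
Proof.
move=> c1 c2 b1 b2 e12 y0.
have mQ Q : (forall y, 0 < y -> {for y, continuous Q}) ->
    measurable_fun (`]0, +oo[ : set R) Q.
  move=> cQ; apply: open_continuous_measurable_fun => // t.
  by rewrite inE/= in_itv/= andbT; exact: cQ.
have key (F1 F2 : R -> R) : (forall y, 0 < y -> {for y, continuous F1}) ->
  (forall y, 0 < y -> {for y, continuous F2}) ->
  (forall y, 0 < y -> `|F1 y| <= C * (1 + y)) ->
  (forall y, 0 < y -> `|F2 y| <= C * (1 + y)) ->
  (forall s : R, 0 < s ->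
    (\int[mu]_(y in `]0%R, +oo[) (expR (- (s * y)) * F1 y)%:E =
     \int[mu]_(y in `]0%R, +oo[) (expR (- (s * y)) * F2 y)%:E)%E) ->
  F1 y <= F2 y.
  move=> {}c1 {}c2 {}b1 {}b2 {}e12; rewrite -subr_le0.
  apply: (@integral_eq0_le (fun y => F1 y - F2 y) (2 * C)) => //.
  - by move=> z z0; apply: cvgB; [exact: c1|exact: c2].
  - move=> z z0; rewrite (le_trans (ler_normB _ _))//.
    by rewrite -mulrA mulr2n mulrDl mul1r lerD ?b1 ?b2.
  - move=> k; have k0 : 0 < k.+1%:R :> R by rewrite ltr0n.
    under eq_Rintegral do rewrite mulrBr.
    rewrite RintegralB//; [|exact: (@integrable_expM _ C _ k0 (mQ _ c1))
      |exact: (@integrable_expM _ C _ k0 (mQ _ c2))].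
    by rewrite /Rintegral e12// subrr.
apply/eqP; rewrite eq_le !key//.
by move=> s s0; rewrite e12.
Qed.

End laplace_injectivity.

(** [F n z] lies above the slope of [Un n] over [[z, z + h]] and below the one over [[z - h, z]].
    With [h] fixed first so that both slopes of the limit are close to its derivative, [n] then
    tends to infinity. *)
Lemma cvg_slope_squeeze (R : realType) (F Un : nat -> R -> R) (U : R -> R)
    (z v : R) :
  (forall n x y, 0 < x -> x < y ->
    (y - x) * F n y <= Un n y - Un n x <= (y - x) * F n x) ->
  (forall x, 0 < x -> Un ^~ x @ \oo --> U x) ->
  0 < z -> is_derive z (1 : R) U v -> F ^~ z @ \oo --> v.
Proof.
move=> slopeF cvgU z0 [dU Uv]; apply/cvgrPdist_le => e e0.
have e2 : 0 < e / 2 by rewrite divr_gt0.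
have : (fun h => h^-1 * (U (h + z) - U z)) @ 0^' --> v.
  rewrite -Uv; move: dU; rewrite /derivable /derive.
  by under eq_fun do rewrite /GRing.scale/= mulr1.
move=> /cvgrPdist_lt/(_ _ e2)[dl /= dl0 hdl].
have {}hdl k : k != 0 -> `|k| < dl -> `|v - k^-1 * (U (k + z) - U z)| < e / 2.
  by move=> k0 kdl; apply: hdl => //=; rewrite sub0r normrN.
(* One bound puts [h] in the range where the difference quotients are close to [v], the other keeps
   [z - h] positive. *)
pose h := Num.min (dl / 2) (z / 2).
have h0 : 0 < h by rewrite lt_min !divr_gt0.
have hdl2 : h < dl.
  by rewrite (@le_lt_trans _ _ (dl / 2)) ?ge_min ?lexx// ltr_pdivrMr// ltr_pMr// ltr1n.
have hz : h < z.
  rewrite (@le_lt_trans _ _ (z / 2)) ?ge_min ?lexx ?orbT//.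
  by rewrite ltr_pdivrMr// ltr_pMr// ltr1n.
have zh0 : 0 < z - h by rewrite subr_gt0.
have zzh : z < z + h by rewrite ltrDl.
have zhz : z - h < z by rewrite ltrBlDr ltrDl.
have hp : `|v - h^-1 * (U (z + h) - U z)| < e / 2.
  by rewrite [z + h]addrC; apply: hdl; rewrite ?gtr0_norm ?gt_eqF.
have hm : `|v - h^-1 * (U z - U (z - h))| < e / 2.
  have := hdl (- h); rewrite normrN gtr0_norm// oppr_eq0 gt_eqF//.
  by move=> /(_ isT hdl2); rewrite [- h + z]addrC invrN mulNr -mulrN opprB.
have cp : h^-1 * (Un n (z + h) - Un n z) @[n --> \oo] --> h^-1 * (U (z + h) - U z).
  apply: cvgM; first exact: cvg_cst.
  by apply: cvgB; apply: cvgU => //; exact: lt_trans zzh.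
have cm : h^-1 * (Un n z - Un n (z - h)) @[n --> \oo] --> h^-1 * (U z - U (z - h)).
  apply: cvgM; first exact: cvg_cst.
  by apply: cvgB; exact: cvgU.
move: cp cm => /cvgrPdist_lt/(_ _ e2) cp /cvgrPdist_lt/(_ _ e2) cm.
near=> n.
have hpn : `|h^-1 * (U (z + h) - U z) - h^-1 * (Un n (z + h) - Un n z)| < e / 2.
  by near: n; exact: cp.
have hmn : `|h^-1 * (U z - U (z - h)) - h^-1 * (Un n z - Un n (z - h))| < e / 2.
  by near: n; exact: cm.
have /andP[_ +] := slopeF n _ _ z0 zzh; have /andP[+ _] := slopeF n _ _ zh0 zhz.
rewrite (_ : z - (z - h) = h); last by ring.
rewrite (_ : z + h - z = h); last by ring.
rewrite -ler_pdivlMl// => h1; rewrite -ler_pdivrMl// => h2.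
move: hpn hmn hp hm; rewrite !ltr_norml ler_norml.
move=> /andP[? ?] /andP[? ?] /andP[? ?] /andP[? ?]; apply/andP; split; lra.
Unshelve. all: by end_near. Qed.

(** * Shape and Laplace transform of the limiting truncated mean *)

Section lim_truncated_mean.
Context d (T : measurableType d) (R : realType) (P : probability T R).
Variables (Z : nat -> T -> R) (c : nat -> R) (L : R -> R).
Hypothesis mZ : forall n, measurable_fun setT (Z n).
Hypothesis Z_ge0 : forall n w, 0 <= Z n w.
Hypothesis c_ge0 : forall n, 0 <= c n.
Hypothesis cvg_L : forall s, 0 < s ->
  c n * \int[P]_w (1 - expR (- (s * Z n w))) @[n --> \oo] --> L s.
Notation mu := (@lebesgue_measure R).
Local Notation Un := (truncated_mean P Z c).
Local Notation U := (lim_truncated_mean P Z c).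

Let cvgU x : 0 < x -> Un ^~ x @ \oo --> U x.
Proof. exact: (cvg_truncated_mean mZ Z_ge0 c_ge0 cvg_L). Qed.

(** For each [n] the rescaled tail at the middle point [y] separates the slope over [[y, z]] from
    the slope over [[x, y]]. *)
Lemma lim_truncated_mean_concave x y z : 0 < x -> x < y -> y < z ->
  (U z - U y) * (y - x) <= (U y - U x) * (z - y).
Proof.
move=> x0 xy yz; have y0 := lt_trans x0 xy; have z0 := lt_trans y0 yz.
apply: (@ler_cvg_to _ \oo _ _ (fun n => (Un n z - Un n y) * (y - x))
    (fun n => (Un n y - Un n x) * (z - y))).
- by apply: cvgM; [apply: cvgB; exact: cvgU|exact: cvg_cst].
- by apply: cvgM; [apply: cvgB; exact: cvgU|exact: cvg_cst].
- apply: nearW => n.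
  have /andP[+ _] := truncated_mean_slope P mZ Z_ge0 c_ge0 n x0 xy.
  have /andP[_] := truncated_mean_slope P mZ Z_ge0 c_ge0 n y0 yz.
  move: (c n * _) => F h1 h2.
  rewrite (le_trans (ler_wpM2r _ h1)) ?subr_ge0 ?(ltW xy)//.
  rewrite (le_trans _ (ler_wpM2r _ h2)) ?subr_ge0 ?(ltW yz)//.
  by rewrite mulrC [leRHS]mulrC mulrCA.
Qed.

Lemma lim_truncated_mean_nd x y : 0 < x -> x <= y -> U x <= U y.
Proof.
move=> x0; rewrite le_eqVlt => /predU1P[->//|xy].
apply: (ler_cvg_to (cvgU x0) (cvgU (lt_trans x0 xy))).
apply: nearW => n; rewrite -subr_ge0.
have /andP[+ _] := truncated_mean_slope P mZ Z_ge0 c_ge0 n x0 xy.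
by apply: le_trans; rewrite !mulr_ge0 ?fine_ge0// subr_ge0 ltW.
Qed.

Lemma lim_truncated_mean_ge0 x : 0 < x -> 0 <= U x.
Proof.
move=> x0; apply: (ler_cvg_to (cvg_cst 0) (cvgU x0)).
by apply: nearW => n; exact: truncated_mean_ge0 (ltW x0).
Qed.

Lemma lim_truncated_mean_le : exists2 C, 0 < C &
  forall x, 0 < x -> U x <= C * (1 + x).
Proof.
have [C C0 hC] := truncated_mean_le mZ Z_ge0 c_ge0 cvg_L; exists C => // x x0.
apply: (ler_cvg_to (cvgU x0) (cvg_cst (C * (1 + x)))).
by apply: nearW => n; exact: hC.
Qed.

Let measurable_Emin n :
  measurable_fun (`]0, +oo[ : set R) (fun y => \int[P]_w Num.min (Z n w) y).
Proof.
apply: nondecreasing_measurable => // x y xy.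
have imin (t : R) : P.-integrable setT (EFin \o (fun w => Num.min (Z n w) t)).
  apply: (@integrable_le_cst _ _ _ _ _ _ `|t|) => //.
  - by rewrite /= probability_setT ltry.
  - by apply: measurable_minr.
  - move=> w _; have [t0|t0] := leP 0 t.
      by rewrite !ger0_norm ?ge_min ?lexx ?orbT// le_min Z_ge0.
    by rewrite min_r// (le_trans (ltW t0)).
apply: le_Rintegral => // w _.
by rewrite le_min ge_min lexx/= ge_min xy orbT.
Qed.

Let measurable_Un n : measurable_fun (`]0, +oo[ : set R) (Un n).
Proof. exact: measurable_funM (measurable_cst _) (measurable_Emin n). Qed.

Lemma laplace_lim_truncated_mean s : 0 < s ->
  (\int[mu]_(y in `]0%R, +oo[) (expR (- (s * y)) * U y)%:E =
   (L s / s ^+ 2)%:E)%E.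
Proof.
move=> s0; have [C C0 hC] := truncated_mean_le mZ Z_ge0 c_ge0 cvg_L.
have [] := @cvg_laplace_integral R Un U C s s0 measurable_Un cvgU.
  by move=> n y y0; rewrite ger0_norm ?hC// truncated_mean_ge0// ltW.
move=> _ /cvg_unique; apply => //.
have -> : (fun n => \int[mu]_(y in `]0%R, +oo[) (expR (- (s * y)) * Un n y)%:E)%E =
    (fun n => (c n * \int[P]_w (1 - expR (- (s * Z n w))) / s ^+ 2)%:E).
  apply/funext => n; rewrite -mulrA EFinM.
  rewrite -(laplace_integral_truncated P (mZ n) (Z_ge0 n) s0) -ge0_integralZl//.
  - by apply: eq_integral => y _; rewrite -EFinM mulrCA.
  - have mexp := @measurable_expRM R s `]0, +oo[%classic.
    have H := measurable_funM mexp (measurable_Emin n).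
    apply/measurable_EFinP; exact: H.
  - move=> y /=; rewrite in_itv/= andbT => y0.
    rewrite lee_fin mulr_ge0 ?expR_ge0// Rintegral_ge0// => w _.
    by rewrite le_min Z_ge0 ltW.
  - by rewrite lee_fin.
apply: cvg_EFin; first exact: nearW.
by apply: cvgM; [exact: cvg_L|exact: cvg_cst].
Qed.

Lemma cvg_tail (z v : R) : 0 < z -> is_derive z (1 : R) U v ->
  c n * fine (P [set w | z < Z n w]) @[n --> \oo] --> v.
Proof.
apply: (cvg_slope_squeeze (F := fun n x => c n * fine (P [set w | x < Z n w]))
  _ cvgU).
by move=> n x y x0 xy; exact: truncated_mean_slope.
Qed.

End lim_truncated_mean.

(** * Complete monotonicity of f(t) / t for a Bernstein function f *)

Section completely_monotone.
Context {R : realType}.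
Implicit Types (f g : R -> R) (a t x : R) (n : nat).

Let deriveM f g x (df dg : R) : is_derive x (1 : R) f df -> is_derive x (1 : R) g dg ->
  is_derive x (1 : R) (fun t => f t * g t) (df * g x + f x * dg).
Proof.
move=> hf hg; apply: is_derive_eq (is_deriveM hf hg) _.
by rewrite /GRing.scale/= addrC [g x * _]mulrC.
Qed.

Let deriveD f g x (df dg : R) : is_derive x (1 : R) f df -> is_derive x (1 : R) g dg ->
  is_derive x (1 : R) (fun t => f t + g t) (df + dg).
Proof. by move=> hf hg; exact: is_deriveD. Qed.

Let derive_subXn a x n :
  is_derive x (1 : R) (fun t => (t - a) ^+ n.+1) (n.+1%:R * (x - a) ^+ n).
Proof.
have d1 : is_derive x (1 : R) (fun t => t - a) 1.
  apply: is_derive_eq (deriveD (is_derive_id x 1) (is_derive_cst (- a) x 1)) _.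
  by rewrite addr0.
elim: n => [|n IH]; first by rewrite expr0 mulr1.
rewrite (_ : (fun t => _) = fun t => (t - a) * (t - a) ^+ n.+1); last first.
  by apply/funext => t; rewrite exprS.
apply: is_derive_eq (deriveM d1 IH) _.
by rewrite -[n.+2%:R]natr1 exprS; ring.
Qed.

Lemma eq_derive1n f g n x : (forall x, 0 < x -> f x = g x) -> 0 < x ->
  f^`(n)%classic x = g^`(n)%classic x.
Proof.
move=> fg; elim: n x => [|n IH] x x0; first by rewrite !derive1n0 fg.
rewrite !derive1nS !derive1E; apply: near_eq_derive; near=> t.
by apply: IH; near: t; exact: lt_nbhsr.
Unshelve. all: by end_near. Qed.

Lemma eq_completely_monotone f g : (forall x, 0 < x -> f x = g x) ->
  completely_monotone f -> completely_monotone g.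
Proof.
move=> fg cf n x x0; have [df sf] := cf n x x0.
split; last by rewrite -(eq_derive1n n fg x0).
apply: near_eq_derivable df; near=> t.
by apply: eq_derive1n => //; near: t; exact: lt_nbhsr.
Unshelve. all: by end_near. Qed.

(** The Taylor polynomial of [f] of degree [n] centered at [t] and evaluated at [a], seen as a
    function of the center. For [a = 0] it is, up to the factor in [G], the derivative of order [n]
    of [f(t) / t]. *)
Fixpoint taylor_sum f a n t : R :=
  if n is m.+1 then
    taylor_sum f a m t + (-1) ^+ n / n`!%:R * ((t - a) ^+ n * f^`(n)%classic t)
  else f t.

Variable f : R -> R.
Hypothesis bf : bernstein f.

Let derivable_f n x : 0 < x -> derivable f^`(n)%classic x 1.
Proof.
have [_ df cf] := bf; case: n => [|n] x0; first by rewrite derive1n0; exact: df.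
by rewrite derive1Sn; have [] := cf n x x0.
Qed.

Let is_derive_f n x : 0 < x -> is_derive x (1 : R) f^`(n)%classic (f^`(n.+1)%classic x).
Proof.
by move=> x0; rewrite derive1nS derive1E; apply: derivableP; exact: derivable_f.
Qed.

Let sign_f n x : 0 < x -> 0 <= (-1) ^+ n * f^`(n.+1)%classic x.
Proof.
by move=> x0; rewrite derive1Sn; have [_ _ cf] := bf; have [] := cf n x x0.
Qed.

(* All terms of the derivative but the last one telescope. *)
Lemma is_derive_taylor_sum a n x : 0 < x ->
  is_derive x (1 : R) (taylor_sum f a n)
    ((-1) ^+ n / n`!%:R * ((x - a) ^+ n * f^`(n.+1)%classic x)).
Proof.
move=> x0; elim: n => [|n IH].
  have := is_derive_f 0 x0; rewrite derive1n0 => h.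
  by apply: is_derive_eq h _; rewrite !expr0 fact0 divr1 !mul1r.
have h1 := deriveM (derive_subXn a x n) (is_derive_f n.+1 x0).
have h2 := deriveM (is_derive_cst ((-1) ^+ n.+1 / n.+1`!%:R : R) x 1) h1.
apply: is_derive_eq (deriveD IH h2) _.
rewrite mul0r add0r /cst factS natrM !exprS.
by field; rewrite nat1r !pnatr_eq0 -lt0n fact_gt0.
Qed.

(** At the center [t = a] the sum reduces to [f a >= 0], and to the right of [a] its derivative has
    the sign of [(-1) ^+ n] times the derivative of [f] of order [n + 1], which is nonnegative. *)
Let taylor_sum_ge0_pos a n x : 0 < a -> a < x -> 0 <= taylor_sum f a n x.
Proof.
move=> a0 ax; have aE : taylor_sum f a n a = f a.
  by elim: n => //= n ->; rewrite subrr expr0n/= mul0r mulr0 addr0.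
have [f0 _ _] := bf.
have [] := @MVT_segment R (taylor_sum f a n)
  (fun x => (-1) ^+ n / n`!%:R * ((x - a) ^+ n * f^`(n.+1)%classic x)) a x (ltW ax).
- move=> t; rewrite in_itv/= => /andP[at_ _].
  by apply: is_derive_taylor_sum; exact: lt_trans at_.
- apply: derivable_within_continuous => t; rewrite in_itv/= => /andP[at_ _].
  by case: (is_derive_taylor_sum a n (lt_le_trans a0 at_)).
move=> t; rewrite in_itv/= => /andP[at_ tx] /eqP.
rewrite subr_eq aE => /eqP ->; rewrite addr_ge0 ?f0//.
rewrite mulr_ge0 ?subr_ge0 ?(ltW ax)//.
have t0 : 0 < t := lt_le_trans a0 at_.
rewrite /= (_ : _ * (_ * _) =
  (-1) ^+ n * f^`(n.+1)%classic t * ((t - a) ^+ n / n`!%:R)); last first.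
  by rewrite derive1nS; ring.
by rewrite mulr_ge0 ?sign_f// divr_ge0// exprn_ge0// subr_ge0.
Qed.

(** Nothing is known about [f] at 0, so the mean value theorem is used from [a > 0] and [a] then
    decreases to 0, the sum being polynomial in [a]. *)
Let taylor_sum_ge0 n x : 0 < x -> 0 <= taylor_sum f 0 n x.
Proof.
move=> x0; have c0 : taylor_sum f a n x @[a --> 0^'+] --> taylor_sum f 0 n x.
  apply: cvg_at_right_filter; elim: n => [|n IH] /=; first exact: cvg_cst.
  apply: cvgD => //; apply: cvgM; first exact: cvg_cst.
  apply: cvgM; last exact: cvg_cst.
  apply: (@continuous_comp _ _ _ (fun a => x - a) (fun y => y ^+ n.+1)).
    by apply: cvgB; [exact: cvg_cst|exact: cvg_id].
  exact: exprn_continuous.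
apply: (ler_cvg_to (cvg_cst 0) c0); near=> a.
apply: taylor_sum_ge0_pos; first by near: a; exact: nbhs_right_gt.
by near: a; exact: nbhs_right_lt.
Unshelve. all: by end_near. Qed.

Let g x := f x / x.

Let G n x := (-1) ^+ n * n`!%:R * ((x ^+ n.+1)^-1 * taylor_sum f 0 n x).

Let is_derive_G n x : 0 < x -> is_derive x (1 : R) (G n) (G n.+1 x).
Proof.
move=> x0; have x0' : x != 0 by rewrite gt_eqF.
have := derive_subXn 0 x n; rewrite subr0 (_ : (fun t => _) = fun t => t ^+ n.+1).
  move=> dX; have xn0 : x ^+ n.+1 != 0 by rewrite expf_neq0.
  have dV := @is_deriveV R (fun t => t ^+ n.+1) x _ 1 xn0 dX.
  have h2 := deriveM (is_derive_cst ((-1) ^+ n * n`!%:R : R) x 1)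
    (deriveM dV (is_derive_taylor_sum 0 n x0)).
  apply: is_derive_eq h2 _.
  rewrite mul0r add0r /cst /G /GRing.scale/= subr0 factS natrM !exprS.
  by field; rewrite nat1r !pnatr_eq0 -lt0n fact_gt0 expf_neq0 x0'.
by apply/funext => t; rewrite subr0.
Qed.

(** Besides making [h] completely monotone when alpha = 1, this puts [h] in the range class of [opA]
    when alpha < 1, since [s^(alpha - 1) h(s) = h(s) s^alpha / s]. *)
Lemma bernstein_div_id : completely_monotone g.
Proof.
have gE n x : 0 < x -> g^`(n)%classic x = G n x.
  elim: n x => [|n IH] x x0.
    by rewrite derive1n0 /g /G/= expr0 fact0 !mul1r expr1 mulrC.
  rewrite derive1nS derive1E.
  have [_ <-] := is_derive_G n x0.
  apply: near_eq_derive; near=> t.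
  by apply: IH; near: t; exact: lt_nbhsr.
move=> n x x0; split.
  have [+ _] := is_derive_G n x0; apply: near_eq_derivable; near=> t.
  by rewrite gE//; near: t; exact: lt_nbhsr.
rewrite gE// /G !mulrA -exprMn mulN1r opprK expr1n mul1r -mulrA.
by rewrite !mulr_ge0// ?invr_ge0 ?exprn_ge0 ?taylor_sum_ge0// ltW.
Unshelve. all: by end_near. Qed.

End completely_monotone.

(** * Constant h and the truncated first moment *)

Lemma completely_monotone_nincr (R : realType) (g : R -> R) (x y : R) :
  completely_monotone g -> 0 < x -> x <= y -> g y <= g x.
Proof.
move=> cg x0; rewrite le_eqVlt => /predU1P[->//|xy].
have dg (t : R) : 0 < t -> is_derive t (1 : R) g (g^`()%classic t).
  move=> t0; rewrite derive1E; apply: derivableP.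
  by have [] := cg 0%N t t0; rewrite derive1n0.
have [] := @MVT_segment R g (g^`()%classic) x y (ltW xy).
- by move=> t; rewrite in_itv/= => /andP[xt _]; apply: dg; exact: lt_trans xt.
- apply: derivable_within_continuous => t; rewrite in_itv/= => /andP[xt _].
  by case: (dg t (lt_le_trans x0 xt)).
move=> t; rewrite in_itv/= => /andP[xt _] gE.
rewrite -subr_le0 gE mulr_le0_ge0 ?subr_ge0 ?(ltW xy)//.
have [_] := cg 1%N t (lt_le_trans x0 xt).
by rewrite derive1n1 expr1 mulN1r oppr_ge0.
Qed.

Lemma archimedean_expr (R : realType) (r x y : R) : 1 < r -> 0 < x ->
  exists n, y <= r ^+ n * x.
Proof.
move=> r1 x0; have r0 : 0 < r := lt_trans ltr01 r1.
have d0 : 0 < r - 1 by rewrite subr_gt0.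
have bernoulli k : k%:R * (r - 1) + 1 <= r ^+ k.
  elim: k => [|k IH]; first by rewrite mul0r add0r expr0.
  rewrite exprS -natr1; apply: le_trans (ler_wpM2l (ltW r0) IH).
  have : 0 <= k%:R * (r - 1) * (r - 1) by rewrite !mulr_ge0// ltW.
  lra.
exists (Num.truncn (y / x / (r - 1))).+1.
rewrite -ler_pdivrMr//; set n := _.+1.
have h1 : y / x <= n%:R * (r - 1).
  by rewrite -ler_pdivrMr//; exact: ltW (truncnS_gt _).
rewrite (le_trans h1)//.
by apply: le_trans (bernoulli n); rewrite lerDl.
Qed.

Lemma periodic_expr (R : realType) (r : R) (h : R -> R) : 0 < r ->
  (forall t, 0 < t -> h (r * t) = h t) ->
  forall n t, 0 < t -> h (r ^+ n * t) = h t.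
Proof.
move=> r0 hr n t t0; elim: n => [|n IH]; first by rewrite expr0 mul1r.
by rewrite exprS -mulrA hr ?IH// mulr_gt0// exprn_gt0.
Qed.

Lemma periodic_nincr_constant (R : realType) (r : R) (h : R -> R) :
  1 < r -> (forall t, 0 < t -> h (r * t) = h t) ->
  (forall x y, 0 < x -> x <= y -> h y <= h x) ->
  forall t, 0 < t -> h t = h 1.
Proof.
move=> r1 hr hni t t0; have r0 : 0 < r := lt_trans ltr01 r1.
have key x y : 0 < x -> 0 < y -> h x <= h y.
  move=> x0 y0; have [n hn] := archimedean_expr y r1 x0.
  by rewrite -(periodic_expr r0 hr n x0) hni.
by apply/eqP; rewrite eq_le !key.
Qed.

(** The least power of [r] that reaches [x] from 1, or 1 from [x], yields a representative [y] that
    serves every multiplicatively periodic function at once. *)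
Lemma periodic_fundamental (R : realType) (r x : R) : 1 < r -> 0 < x ->
  exists2 y, 1 <= y <= r & forall f : R -> R,
    (forall t, 0 < t -> f (r * t) = f t) -> f x = f y.
Proof.
move=> r1 x0; have r0 : 0 < r := lt_trans ltr01 r1.
have [x1|x1] := leP 1 x.
  have [m xm] := archimedean_expr x r1 ltr01.
  have exm : exists m, x <= r ^+ m by exists m; rewrite -[r ^+ m]mulr1.
  case: (ex_minnP exm) => -[|k] xk kmin.
    exists 1; first by rewrite lexx ltW.
    by move=> f _; congr f; apply/eqP; rewrite eq_le x1 andbT.
  have rk0 : 0 < r ^+ k by rewrite exprn_gt0.
  exists (x / r ^+ k).
    rewrite ler_pdivlMr// mul1r ler_pdivrMr// -exprS xk andbT.
    by rewrite leNgt; apply/negP => /ltW/kmin; rewrite ltnn.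
  move=> f fr; rewrite -(periodic_expr r0 fr k (divr_gt0 x0 rk0)).
  by rewrite mulrC divfK// gt_eqF.
have [m xm] := archimedean_expr 1 r1 x0.
have exm : exists m, 1 <= r ^+ m * x by exists m.
case: (ex_minnP exm) => -[|k] xk kmin.
  by move: xk; rewrite expr0 mul1r leNgt x1.
exists (r ^+ k.+1 * x).
  rewrite xk/= exprS -mulrA ler_piMr ?(ltW r0)// leNgt; apply/negP => /ltW/kmin.
  by rewrite ltnn.
by move=> f fr; rewrite (periodic_expr r0 fr).
Qed.

Section truncated_first_moment.
Context d (T : measurableType d) (R : realType) (P : probability T R).
Variable X : {RV P >-> R}.
Hypothesis X_ge0 : forall w, 0 <= X w.

Let E (g : R -> R) := \int[P]_w g (X w).

Let integrable_bounded (g : R -> R) (M : R) : measurable_fun setT g ->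
  (forall z, 0 <= z -> `|g z| <= M) -> P.-integrable setT (EFin \o (g \o X)).
Proof.
move=> mg gM; apply: (@integrable_le_cst _ _ _ _ _ _ M) => //.
- by rewrite /= probability_setT ltry.
- exact: measurableT_comp.
- by move=> w _; exact: gM.
Qed.

Let J (x z : R) : R := if z <= x then z else 0.

Let mJ x : measurable_fun setT (J x).
Proof.
apply: measurable_fun_ifT => //.
by apply: measurable_fun_ler.
Qed.

Let truncated_momentE x : 0 < x ->
  \int[distribution P X]_(y in `[0, x]) y = E (J x).
Proof.
move=> x0; rewrite /Rintegral integral_mkcond; congr fine.
rewrite ge0_integral_distribution.
- apply: eq_integral => w _; rewrite /= patchE mem_setE in_itv/= X_ge0/= /J.
  by case: ifP.
- apply/(measurable_restrictT _ _).1 => //.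
- move=> y; rewrite patchE mem_setE in_itv/=; case: ifPn => // /andP[y0 _].
  by rewrite lee_fin.
Qed.

Let V (x z : R) : R := expR (- (x^-1 * z)).

Let mV x : measurable_fun setT (V x).
Proof. exact: measurable_expRM. Qed.

Let V01 (x z : R) : 0 < x -> 0 <= z -> 0 <= V x z <= 1.
Proof.
move=> x0 z0; rewrite expR_ge0 -expR0 ler_expR oppr_le0 mulr_ge0//.
by rewrite invr_ge0 ltW.
Qed.

Let A (x : R) : R := x * (1 - laplace X x^-1).
Let B (x : R) : R := x / 2 * (1 - laplace X (2 / x)).

Let integrableV x : 0 < x -> P.-integrable setT (EFin \o (V x \o X)).
Proof.
move=> x0; apply: (@integrable_bounded _ 1) => // z z0.
by have /andP[? ?] := V01 x0 z0; rewrite ger0_norm.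
Qed.

Let E1 : E (fun=> 1) = 1.
Proof. by rewrite /E Rintegral_cst// mul1r /= probability_setT. Qed.

Let i1 : P.-integrable setT (EFin \o cst (1 : R)).
Proof. by apply: (@integrable_bounded (cst 1) 1) => // z _; rewrite normr1. Qed.

Let AE x : 0 < x -> A x = E (fun z => x * (1 - V x z)).
Proof.
move=> x0; rewrite /A /E RintegralZl//.
  rewrite RintegralB//; last exact: integrableV.
  by congr (_ * (_ - _)); exact: esym E1.
exact: (@integrableB _ _ _ P _ measurableT _ _ i1 (integrableV x0)).
Qed.

Let V2 (x z : R) : 0 < x -> V (x / 2) z = V x z ^+ 2.
Proof.
by move=> x0; rewrite /V -expRM_natl; congr expR; field; rewrite gt_eqF.
Qed.

Let ABE x : 0 < x -> A x - B x = E (fun z => x / 2 * (1 - V x z) ^+ 2).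
Proof.
move=> x0; have x20 : 0 < x / 2 by rewrite divr_gt0.
have -> : B x = A (x / 2) by rewrite /A /B invf_div.
rewrite !AE// /E -RintegralB//.
- apply: eq_Rintegral => w _; rewrite V2//; by field.
- apply: (@integrable_bounded (fun z => x * (1 - V x z)) x).
    by apply: measurable_funM => //; exact: measurable_funB.
  move=> z z0; have /andP[? ?] := V01 x0 z0.
  rewrite ger0_norm ?mulr_ge0 ?subr_ge0 ?(ltW x0)//.
  by rewrite ler_piMr ?(ltW x0)// lerBlDr lerDl.
- apply: (@integrable_bounded (fun z => x / 2 * (1 - V (x / 2) z)) (x / 2)).
    by apply: measurable_funM => //; exact: measurable_funB.
  move=> z z0; have /andP[? ?] := V01 x20 z0.
  have h : 0 <= 1 - V (x / 2) z by rewrite subr_ge0.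
  rewrite ger0_norm; last exact: mulr_ge0 (ltW x20) h.
  by rewrite ler_piMr// ?(ltW x20)// lerBlDr lerDl.
Qed.

Let integrableA (x a b : R) : 0 < x ->
  P.-integrable setT (EFin \o ((fun z => a * (x * (1 - V x z)) +
    b * (x / 2 * (1 - V x z) ^+ 2)) \o X)).
Proof.
move=> x0; apply: (@integrable_bounded _ (`|a| * x + `|b| * x)).
  have m1 : measurable_fun setT (fun z => 1 - V x z) by exact: measurable_funB.
  apply: measurable_funD; apply: measurable_funM => //; apply: measurable_funM => //.
  exact: measurable_funX.
move=> z z0; have /andP[V0 V1] := V01 x0 z0.
have V1' : 0 <= 1 - V x z by rewrite subr_ge0.
have V1'' : 1 - V x z <= 1 by rewrite lerBlDr lerDl.
rewrite (le_trans (ler_normD _ _))// normrM [X in _ + X]normrM.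
rewrite (ger0_norm (mulr_ge0 (ltW x0) V1')).
have hB : 0 <= x / 2 * (1 - V x z) ^+ 2.
  by rewrite mulr_ge0 ?exprn_ge0// divr_ge0// ltW.
rewrite (ger0_norm hB) lerD// ler_wpM2l//; first by rewrite ler_piMr// ltW.
have : (1 - V x z) ^+ 2 <= 1 by rewrite expr_le1.
nra.
Qed.

Let E_lin (x a b : R) : 0 < x ->
  E (fun z => a * (x * (1 - V x z)) + b * (x / 2 * (1 - V x z) ^+ 2)) =
  a * A x + b * (A x - B x).
Proof.
move=> x0; rewrite ABE// AE// /E RintegralD//.
- congr (_ + _); rewrite RintegralZl//.
  + have := integrableA 1 0 x0; congr (_.-integrable _ _).
    by apply/funext => w; rewrite /= mul0r addr0 mul1r.
  + have := integrableA 0 1 x0; congr (_.-integrable _ _).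
    by apply/funext => w; rewrite /= mul0r add0r mul1r.
- have := integrableA a 0 x0; congr (_.-integrable _ _).
  by apply/funext => w; rewrite /= mul0r addr0.
- have := integrableA 0 b x0; congr (_.-integrable _ _).
  by apply/funext => w; rewrite /= mul0r add0r.
Qed.

Let integrableJ x : 0 < x -> P.-integrable setT (EFin \o (J x \o X)).
Proof.
move=> x0; apply: (@integrable_bounded _ x) => // z z0; rewrite /J.
by case: ifPn => zx; rewrite ?normr0 ?(ltW x0)// ger0_norm.
Qed.

Let x1V_le (x z : R) : 0 < x -> 0 <= z -> x * (1 - V x z) <= z.
Proof.
move=> x0 z0; rewrite mulrC -ler_pdivlMr//.
have := expR_ge1Dx (- (x^-1 * z)); rewrite -/(V x z) [z / x]mulrC; lra.
Qed.

(** With [v = z / x] this is [v <= exp(v) - 1 = exp(v) (1 - exp(- v))] together with [v <= a]. *)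
Let le_x1V (x z a : R) : 0 < x -> 0 <= z -> z <= a * x ->
  z <= expR a * (x * (1 - V x z)).
Proof.
move=> x0 z0 za; set v := x^-1 * z.
have v0 : 0 <= v by rewrite mulr_ge0// invr_ge0 ltW.
have va : v <= a by rewrite /v mulrC ler_pdivrMr.
have -> : z = x * v by rewrite /v mulrA divff ?mul1r// gt_eqF.
rewrite [leRHS]mulrCA ler_wpM2l ?(ltW x0)//.
apply: (@le_trans _ _ (expR v * (1 - expR (- v)))).
  rewrite mulrBr mulr1 -expRD subrr expR0.
  by have := expR_ge1Dx v; lra.
have -> : V x (x * v) = expR (- v).
  by rewrite /V mulrA mulVf ?mul1r// gt_eqF.
rewrite ler_wpM2r ?ler_expR// subr_ge0 -expR0 ler_expR; lra.
Qed.

(** A lower bound for [1 - V x z] when [z > a x]: there [(1 - V)^2 / K a] dominates [1 - V], so the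
    quadratic error term controls large values of [X]. *)
Let K (a : R) := 1 - expR (- a).

Let K0 a : 0 < a -> 0 < K a.
Proof. by move=> a0; rewrite subr_gt0 -expR0 ltr_expR oppr_lt0. Qed.

Let K_le (x z a : R) : 0 < x -> a * x < z -> K a <= 1 - V x z.
Proof.
move=> x0 az; rewrite lerB// ler_expR lerN2 mulrC ler_pdivlMr//.
exact: ltW.
Qed.

(** For [z <= x] the term [x (1 - V)] is already at most [z]; for [z > x], where [J] vanishes, the
    subtracted quadratic term outweighs it. *)
Let J_ge x : 0 < x -> 1 * A x + (- (2 / K 1)) * (A x - B x) <= E (J x).
Proof.
move=> x0; rewrite -E_lin//; apply: le_Rintegral => //.
- exact: integrableA.
- exact: integrableJ.
move=> w _; rewrite /J; have z0 := X_ge0 w.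
move: (X w) z0 => z z0; have /andP[V0 V1] := V01 x0 z0.
have V1' : 0 <= 1 - V x z by rewrite subr_ge0.
have K10 : 0 < K 1 by exact: K0.
case: ifPn => zx.
  rewrite mul1r (le_trans _ (x1V_le x0 z0))// gerDl mulNr oppr_le0.
  have ? := ltW x0; have ? := ltW K10.
  by rewrite !mulr_ge0 ?invr_ge0 ?exprn_ge0.
rewrite -ltNge in zx.
have h : K 1 <= 1 - V x z by apply: K_le; rewrite ?mul1r.
rewrite (_ : _ + _ = x * (1 - V x z) * (1 - (1 - V x z) / K 1)); last first.
  by field; rewrite gt_eqF.
by rewrite mulr_ge0_le0 ?mulr_ge0 ?(ltW x0)// subr_le0 ler_pdivlMr// mul1r.
Qed.

(** For [z <= a x] the linear term alone suffices, with a constant close to 1 when [a] is small. For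
    [a x < z <= x] the constant is only [exp(1)], but this part is absorbed by the quadratic term,
    negligible for fixed [a]. *)
Let J_le x a : 0 < x -> 0 < a ->
  E (J x) <= expR a * A x + (2 * expR 1 / K a) * (A x - B x).
Proof.
move=> x0 a0; rewrite -E_lin//; apply: le_Rintegral => //.
- exact: integrableJ.
- exact: integrableA.
move=> w _; rewrite /J; have z0 := X_ge0 w.
move: (X w) z0 => z z0; have /andP[V0 V1] := V01 x0 z0.
have V1' : 0 <= 1 - V x z by rewrite subr_ge0.
have Ka0 := K0 a0.
have ? := ltW x0; have ? := ltW Ka0.
have h1 : 0 <= expR a * (x * (1 - V x z)) by rewrite !mulr_ge0 ?expR_ge0.
have h2 : 0 <= 2 * expR 1 / K a * (x / 2 * (1 - V x z) ^+ 2).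
  by rewrite !mulr_ge0 ?invr_ge0 ?expR_ge0 ?exprn_ge0.
case: ifPn => zx; last by rewrite addr_ge0.
have [za|za] := leP z (a * x).
  by rewrite (le_trans (le_x1V x0 z0 za))// lerDl.
have h3 : K a <= 1 - V x z by exact: K_le.
have h4 : z <= expR 1 * (x * (1 - V x z)) by apply: le_x1V; rewrite ?mul1r.
rewrite (le_trans h4)// ler_wpDl//.
rewrite (_ : _ * (x / 2 * _) =
  expR 1 * (x * (1 - V x z)) * ((1 - V x z) / K a)); last first.
  by field; rewrite gt_eqF.
by rewrite ler_peMr ?ler_pdivlMr ?mul1r// !mulr_ge0 ?expR_ge0.
Qed.

Let cvg_combination (a b : R) (F G : R -> R) :
  F x @[x --> +oo] --> (1 : R) -> G x @[x --> +oo] --> (1 : R) ->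
  a * F x + b * (F x - G x) @[x --> +oo] --> a.
Proof.
move=> F1 G1.
rewrite -[X in _ --> X](_ : a * 1 + b * (1 - 1) = a); last by ring.
apply: cvgD; apply: cvgM; [exact: cvg_cst|exact: F1|exact: cvg_cst|].
exact: cvgB.
Qed.

Variable D : R -> R.
Hypothesis D0 : forall x, 0 < x -> 0 < D x.
Hypothesis cvgA : x * (1 - laplace X x^-1) / D x @[x --> +oo] --> (1 : R).
Hypothesis cvgB' : x / 2 * (1 - laplace X (2 / x)) / D x @[x --> +oo] --> (1 : R).

Lemma cvg_truncated_first_moment :
  (\int[distribution P X]_(y in `[0, x]) y) / D x @[x --> +oo] --> (1 : R).
Proof.
apply/cvgrPdist_le => e e0.
(* The upper bound then converges to [1 + e / 2], which leaves [e / 2] for the speed of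
   convergence. *)
pose a := ln (1 + e / 2).
have e2 : 0 < e / 2 by rewrite divr_gt0.
have e21 : 1 < 1 + e / 2 by rewrite ltrDl.
have a0 : 0 < a by rewrite ln_gt0.
have aE : expR a = 1 + e / 2 by rewrite lnK// posrE (lt_trans ltr01).
have := @cvg_combination 1 (- (2 / K 1)) _ _ cvgA cvgB'.
have := @cvg_combination (expR a) (2 * expR 1 / K a) _ _ cvgA cvgB'.
move=> /cvgrPdist_le/(_ _ e2) hi /cvgrPdist_le/(_ _ e2) lo.
pose lo_ x := 1 * (A x / D x) + (- (2 / K 1)) * (A x / D x - B x / D x).
pose hi_ x := expR a * (A x / D x) + (2 * expR 1 / K a) * (A x / D x - B x / D x).
near=> x.
have x0 : 0 < x by near: x; exact: nbhs_pinfty_gt.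
have hlo : `|1 - lo_ x| <= e / 2.
  by near: x; exact: lo.
have hhi : `|expR a - hi_ x| <= e / 2.
  by near: x; exact: hi.
rewrite truncated_momentE//.
have i0 : 0 <= (D x)^-1 by rewrite invr_ge0 ltW// D0.
have := ler_wpM2r i0 (J_ge x0); have := ler_wpM2r i0 (J_le x0 a0).
rewrite (_ : (expR a * A x + _) / D x = hi_ x); last by rewrite /hi_; ring.
rewrite (_ : (1 * A x + _) / D x = lo_ x); last by rewrite /lo_; ring.
move: hlo hhi; rewrite !ler_norml aE.
move: (hi_ x) (lo_ x) (E _ / _) => p q s.
by move=> /andP[? ?] /andP[? ?] ? ?; apply/andP; split; lra.
Unshelve. all: by end_near. Qed.

End truncated_first_moment.

(** * The rescaled solution *)

Section scaling_limit.
Context d (T : measurableType d) (R : realType) (P : probability T R).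
Context dW (TW : measurableType dW) (PW : probability TW R).
Variables (X : {RV P >-> R}) (W : {RV PW >-> R}).
Variables (alpha r : R) (h l : R -> R).
Hypothesis X_ge0 : forall w, 0 <= X w.
Hypothesis alpha_gt0 : 0 < alpha.
Hypothesis r_gt1 : 1 < r.
Hypothesis h_gt0 : forall t, 0 < t -> 0 < h t.
Hypothesis h_per : forall t, 0 < t -> h (r * t) = h t.
Hypothesis X_laplace : forall t, 0 <= t ->
  laplace X t = laplace W (h t * t `^ alpha).
Hypothesis l_slow : slowly_varying +oo l.
Hypothesis l_def : forall t, 0 < t -> 1 - laplace W t = t * l t^-1.

Definition scale_norm (n : nat) : R :=
  r `^ (alpha * n%:R) / l (r `^ (alpha * n%:R)).
Definition rescaled (n : nat) (w : T) : R := X w / r ^+ n.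

Let r_gt0 : 0 < r. Proof. exact: lt_trans ltr01 r_gt1. Qed.

Let l_gt0 x : 0 < x -> 0 < l x. Proof. by case: l_slow => _ + _; exact. Qed.

Let cvg_l k : 0 < k -> l (k * x) / l x @[x --> +oo] --> (1 : R).
Proof. by case: l_slow => _ _; exact. Qed.

Lemma measurable_rescaled n : measurable_fun setT (rescaled n).
Proof. by apply: measurable_funM => //; exact: measurable_funP. Qed.

Lemma rescaled_ge0 n w : 0 <= rescaled n w.
Proof. by rewrite divr_ge0// exprn_ge0// ltW. Qed.

Lemma scale_norm_gt0 n : 0 < scale_norm n.
Proof. by rewrite divr_gt0 ?l_gt0 ?powR_gt0. Qed.

Let one_sub_laplace t : 0 < t ->
  1 - laplace X t = h t * t `^ alpha * l (h t * t `^ alpha)^-1.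
Proof.
by move=> t0; rewrite X_laplace ?(ltW t0)// l_def// mulr_gt0 ?h_gt0// powR_gt0.
Qed.

Let powR_gt1 a : 0 < a -> 1 < r `^ a.
Proof.
move=> a0; have -> : 1 = 1 `^ a :> R by rewrite powR1.
by rewrite gt0_ltr_powR ?nnegrE ?ler01 ?(ltW r_gt0).
Qed.

Let rn n : r `^ (alpha * n%:R) = (r ^+ n) `^ alpha.
Proof. by rewrite -powR_mulrn ?(ltW r_gt0)// -powRrM mulrC. Qed.

Let cvgy_rn : r `^ (alpha * n%:R) @[n --> \oo] --> +oo.
Proof.
have ra1 : 1 < r `^ alpha by exact: powR_gt1.
apply/cvgryPge => M.
have [k hk] := archimedean_expr M ra1 ltr01.
near=> n; rewrite (le_trans hk)// mulr1 powRrM powR_mulrn ?powR_ge0//.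
rewrite ler_eXn2l//.
by near: n; exists k.
Unshelve. all: by end_near. Qed.

(** With [H = h(s) s^alpha] and [x = r^(alpha n)], periodicity gives [1 - E[exp(- s Z_n)] = (H / x)
    l(x / H)]. Multiplied by [x / l(x)], this is [H] times a ratio tending to 1. *)
Lemma cvg_rescaled_laplace s : 0 < s ->
  scale_norm n * \int[P]_w (1 - expR (- (s * rescaled n w))) @[n --> \oo]
    --> h s * s `^ alpha.
Proof.
move=> s0; have H0 : 0 < h s * s `^ alpha by rewrite mulr_gt0 ?h_gt0// powR_gt0.
have H1 : 0 < (h s * s `^ alpha)^-1 by rewrite invr_gt0.
have -> : (fun n => scale_norm n * \int[P]_w (1 - expR (- (s * rescaled n w)))) =
  (fun n => h s * s `^ alpha * (l ((h s * s `^ alpha)^-1 * r `^ (alpha * n%:R)) /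
     l (r `^ (alpha * n%:R)))).
  apply/funext => n; have rn0 : 0 < r ^+ n by rewrite exprn_gt0.
  have sn0 : 0 < s / r ^+ n by rewrite divr_gt0.
  have i1 : P.-integrable setT (EFin \o cst (1 : R)).
    by apply: (@integrable_le_cst _ _ _ _ _ (cst 1) 1) => //;
      [rewrite /= probability_setT ltry|move=> w _; rewrite normr1].
  have ie : P.-integrable setT (EFin \o (fun w => expR (- (s * rescaled n w)))).
    apply: (@integrable_le_cst _ _ _ _ _ _ 1) => //.
    - by rewrite /= probability_setT ltry.
    - exact: measurableT_comp (@measurable_expRM R s setT) (measurable_rescaled n).
    - move=> w _; rewrite ger0_norm ?expR_ge0// -expR0 ler_expR oppr_le0.
      by rewrite mulr_ge0 ?rescaled_ge0// ltW.
  have -> : \int[P]_w (1 - expR (- (s * rescaled n w))) =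
      1 - laplace X (s / r ^+ n).
    rewrite (RintegralB measurableT i1 ie); congr (_ - _).
      by rewrite Rintegral_cst// mul1r /= probability_setT.
    apply: eq_Rintegral => w _; congr (expR (- _)).
    by rewrite /rescaled mulrA mulrAC.
  rewrite one_sub_laplace//.
  have -> : h (s / r ^+ n) = h s.
    rewrite -(periodic_expr r_gt0 h_per n sn0); congr h.
    by rewrite mulrC divfK// gt_eqF.
  have -> : h s * (s / r ^+ n) `^ alpha = h s * s `^ alpha / r `^ (alpha * n%:R).
    rewrite powRM ?invr_ge0 ?(ltW s0) ?(ltW rn0)// -mulrA rn; congr (_ * (_ * _)).
    rewrite -powRN -[(r ^+ n)^-1]powR_inv1 ?(ltW rn0)// -powRrM.
    by rewrite mulN1r.
  rewrite invf_div [r `^ _ / _]mulrC /scale_norm.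
  have : r `^ (alpha * n%:R) != 0 by rewrite gt_eqF// powR_gt0.
  have : l (r `^ (alpha * n%:R)) != 0 by rewrite gt_eqF// l_gt0// powR_gt0.
  by move=> b0 c0; field; rewrite b0 c0.
rewrite -[X in _ --> X]mulr1; apply: cvgM; first exact: cvg_cst.
exact: cvg_comp cvgy_rn (cvg_l H1).
Qed.

Let scale_norm_ge0 n : 0 <= scale_norm n. Proof. exact: ltW (scale_norm_gt0 n). Qed.

Local Notation Un := (truncated_mean P rescaled scale_norm).
Definition limit_mean := lim_truncated_mean P rescaled scale_norm.
Local Notation U := limit_mean.

Let cvgU x : 0 < x -> Un ^~ x @ \oo --> U x.
Proof.
exact: (cvg_truncated_mean measurable_rescaled rescaled_ge0 scale_norm_ge0
  cvg_rescaled_laplace).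
Qed.

(** Since [min(Z_n, r x) = r min(Z_(n+1), x)], [U_n(r x)] is [r c_n / c_(n+1)] times [U_(n+1)(x)],
    and the quotient of normalizations tends to [r^(- alpha)] by slow variation. *)
Lemma limit_mean_scale x : 0 < x -> U (r * x) = r `^ (1 - alpha) * U x.
Proof.
move=> x0; have rx0 : 0 < r * x by rewrite mulr_gt0.
have ra0 : 0 < r `^ alpha by rewrite powR_gt0.
have cS : (fun n => Un n.+1 x) @ \oo --> U x.
  by have := cvgU x0; rewrite -(cvg_shiftS (Un ^~ x)).
have cl : (fun n => l (r `^ alpha * r `^ (alpha * n%:R)) / l (r `^ (alpha * n%:R)))
    @ \oo --> (1 : R).
  exact: cvg_comp cvgy_rn (cvg_l ra0).
have cR := cvgM (cvgM (cvg_cst (r `^ (1 - alpha))) cl) cS.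
rewrite mulr1 in cR.
apply: cvg_unique (cvgU rx0) _ => //.
suff -> : Un ^~ (r * x) = (fun n => r `^ (1 - alpha) *
    (l (r `^ alpha * r `^ (alpha * n%:R)) / l (r `^ (alpha * n%:R))) * Un n.+1 x).
  exact: cR.
apply/funext => n.
rewrite /truncated_mean.
have -> : \int[P]_w Num.min (rescaled n w) (r * x) =
    \int[P]_w (r * Num.min (rescaled n.+1 w) x).
  apply: eq_Rintegral => w _; rewrite /rescaled minr_pMr ?(ltW r_gt0)//.
  congr (Num.min _ _); rewrite exprS; field.
  by rewrite !gt_eqF ?exprn_gt0.
rewrite RintegralZl//; last first.
  apply: (@integrable_le_cst _ _ _ _ _ _ x) => //.
  - by rewrite /= probability_setT ltry.
  - by apply: measurable_minr => //; exact: measurable_rescaled.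
  - move=> w _; rewrite ger0_norm ?ge_min ?lexx ?orbT//.
    by rewrite le_min rescaled_ge0 ltW.
have rS : r `^ (alpha * n.+1%:R) = r `^ alpha * r `^ (alpha * n%:R).
  by rewrite -natr1 mulrDr mulr1 addrC powRD// (gt_eqF r_gt0) implybT.
rewrite /scale_norm rS powRB ?(gt_eqF r_gt0) ?implybT// powRr1 ?(ltW r_gt0)//.
set I := \int[P]_w _; set a := r `^ alpha; set b := r `^ (alpha * n%:R).
have b0 : 0 < b by rewrite powR_gt0.
have lb0 : l b != 0 by rewrite gt_eqF// l_gt0.
have lab0 : l (a * b) != 0 by rewrite gt_eqF// l_gt0// mulr_gt0.
by field; rewrite lb0 lab0 gt_eqF.
Qed.

Lemma laplace_limit_mean s : 0 < s ->
  (\int[lebesgue_measure]_(y in `]0%R, +oo[) (expR (- (s * y)) * U y)%:E =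
   (h s * s `^ alpha / s ^+ 2)%:E)%E.
Proof.
exact: (laplace_lim_truncated_mean measurable_rescaled rescaled_ge0
  scale_norm_ge0 cvg_rescaled_laplace).
Qed.

Lemma limit_mean_concave x y z : 0 < x -> x < y -> y < z ->
  (U z - U y) * (y - x) <= (U y - U x) * (z - y).
Proof.
exact: (lim_truncated_mean_concave measurable_rescaled rescaled_ge0
  scale_norm_ge0 cvg_rescaled_laplace).
Qed.

Lemma limit_mean_nd x y : 0 < x -> x <= y -> U x <= U y.
Proof.
exact: (lim_truncated_mean_nd measurable_rescaled rescaled_ge0
  scale_norm_ge0 cvg_rescaled_laplace).
Qed.

Lemma limit_mean_le : exists2 C, 0 < C & forall x, 0 < x -> U x <= C * (1 + x).
Proof.
exact: (lim_truncated_mean_le measurable_rescaled rescaled_ge0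
  scale_norm_ge0 cvg_rescaled_laplace).
Qed.

Lemma cvg_rescaled_tail (z v : R) : 0 < z -> is_derive z (1 : R) U v ->
  scale_norm n * fine (P [set w | r ^+ n * z < X w]) @[n --> \oo] --> v.
Proof.
move=> z0 dU.
have := cvg_tail measurable_rescaled rescaled_ge0 scale_norm_ge0
  cvg_rescaled_laplace z0 dU.
suff -> : (fun n => scale_norm n * fine (P [set w | r ^+ n * z < X w])) =
    (fun n => scale_norm n * fine (P [set w | z < rescaled n w])) by [].
apply/funext => n; congr (_ * fine (P _)); apply/funext => w /=.
by rewrite /rescaled ltr_pdivlMr ?exprn_gt0// mulrC.
Qed.

Hypothesis alpha_lt1 : alpha < 1.

Let r1a : 1 < r `^ (1 - alpha).
Proof.
by apply: powR_gt1; rewrite subr_gt0.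
Qed.

Let limit_mean_scaleX n x : 0 < x -> U (r ^+ n * x) = (r `^ (1 - alpha)) ^+ n * U x.
Proof.
move=> x0; elim: n => [|n IH]; first by rewrite !expr0 !mul1r.
by rewrite !exprS -!mulrA limit_mean_scale ?IH// mulr_gt0// exprn_gt0.
Qed.

Lemma limit_mean_ge0 x : 0 < x -> 0 <= U x.
Proof.
exact: (lim_truncated_mean_ge0 measurable_rescaled rescaled_ge0
  scale_norm_ge0 cvg_rescaled_laplace).
Qed.

(** A zero of [U] would spread to the whole half-line by scaling and monotonicity, against the
    transform at [s = 1] being [h 1 > 0]. *)
Lemma limit_mean_gt0 x : 0 < x -> 0 < U x.
Proof.
move=> x0; rewrite lt_neqAle limit_mean_ge0// andbT; apply/eqP => U0.
have := laplace_limit_mean ltr01; rewrite integral0_eq.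
  rewrite powR1 expr1n mulr1 divr1 => -[] /eqP.
  by rewrite lt_eqF// h_gt0.
move=> y; rewrite /= in_itv/= andbT => y0.
have [n hn] := archimedean_expr y r_gt1 x0.
have : U y <= 0.
  by rewrite (le_trans (limit_mean_nd y0 hn))// limit_mean_scaleX// -U0 mulr0.
move=> Uy; rewrite (_ : U y = 0) ?mulr0//.
by apply/eqP; rewrite eq_le Uy limit_mean_ge0.
Qed.

Lemma limit_mean_cvg0 : U x @[x --> 0^'+] --> 0.
Proof.
apply/cvgrPdist_le => e e0.
(* By scaling, [U (r ^- n)] is [U 1] divided by the power [n] of [r^(1 - alpha) > 1], so it drops
   below [e]. *)
have [n hn] := archimedean_expr (U 1) r1a e0.
have rn0 : 0 < r ^- n by rewrite invr_gt0 exprn_gt0.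
near=> x.
have x0 : 0 < x by near: x; exact: nbhs_right_gt.
have xn : x <= r ^- n by near: x; exact: nbhs_right_le.
rewrite sub0r normrN ger0_norm ?limit_mean_ge0//.
rewrite (le_trans (limit_mean_nd x0 xn))//.
have := limit_mean_scaleX n rn0; rewrite divff; last by rewrite expf_neq0// gt_eqF.
move=> U1; rewrite U1 in hn; move: hn; rewrite ler_pM2l// exprn_gt0//.
exact: lt_trans r1a.
Unshelve. all: by end_near. Qed.

End scaling_limit.

(** * Existence and uniqueness of p and q *)

Section profile.
Context {R : realType}.
Notation mu := (@lebesgue_measure R).
Variables (alpha r : R) (h U : R -> R).
Hypothesis alpha_gt0 : 0 < alpha.
Hypothesis alpha_lt1 : alpha < 1.
Hypothesis r_gt1 : 1 < r.
Hypothesis h_gt0 : forall t, 0 < t -> 0 < h t.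
Hypothesis h_per : forall t, 0 < t -> h (r * t) = h t.
Hypothesis h_bernstein : bernstein (fun t => h t * t `^ alpha).
Hypothesis U_concave : forall x y z, 0 < x -> x < y -> y < z ->
  (U z - U y) * (y - x) <= (U y - U x) * (z - y).
Hypothesis U_nd : forall x y, 0 < x -> x <= y -> U x <= U y.
Hypothesis U_cvg0 : U x @[x --> 0^'+] --> 0.
Hypothesis U_gt0 : forall x, 0 < x -> 0 < U x.
Hypothesis U_scale : forall x, 0 < x -> U (r * x) = r `^ (1 - alpha) * U x.
Hypothesis U_le : exists2 C, 0 < C & forall x, 0 < x -> U x <= C * (1 + x).
Hypothesis U_laplace : forall s, 0 < s ->
  (\int[mu]_(y in `]0%R, +oo[) (expR (- (s * y)) * U y)%:E =
   (h s * s `^ alpha / s ^+ 2)%:E)%E.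

Let r_gt0 : 0 < r. Proof. exact: lt_trans ltr01 r_gt1. Qed.
Let rho_gt0 : 0 < 1 - alpha. Proof. by rewrite subr_gt0. Qed.
Local Notation u := (right_slope U).

Let powR_unitD (x a b : R) : 0 < x -> x `^ (a + b) = x `^ a * x `^ b.
Proof. by move=> x0; rewrite powRD// (gt_eqF x0) implybT. Qed.

Let U_scaleV x : 0 < x -> U x = r `^ (alpha - 1) * U (r * x).
Proof.
move=> x0; rewrite U_scale// mulrA -powR_unitD// addrC subrKA subrr.
by rewrite powRr0 mul1r.
Qed.

(** The scaling relation of [U] is differentiated on the defining suprema, through the substitution
    [y = r y']. *)
Let u_scale x : 0 < x -> u (r * x) = r `^ (- alpha) * u x.
Proof.
move=> x0; have rx0 : 0 < r * x by rewrite mulr_gt0.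
have ra0 a : 0 < r `^ a by rewrite powR_gt0.
have E1 : r `^ (1 - alpha) = r * r `^ (- alpha).
  by rewrite powR_unitD// powRr1// ltW.
apply/eqP; rewrite eq_le; apply/andP; split.
  apply: right_slope_le => // y xy.
  have [y' -> xy'] : exists2 y', y = r * y' & x < y'.
    exists (y / r); first by rewrite mulrC divfK// gt_eqF.
    by rewrite ltr_pdivlMr// mulrC.
  have y'0 := lt_trans x0 xy'.
  rewrite !U_scale// -mulrBr -mulrBr E1 -!mulrA ler_wpM2l ?(ltW r_gt0)//.
  rewrite [leRHS]mulrCA ler_wpM2l ?(ltW (ra0 _))//.
  exact: le_right_slope.
rewrite powRN mulrC ler_pdivrMr//; apply: right_slope_le => // y xy.
have y0 := lt_trans x0 xy.
have := le_right_slope U_concave rx0 (_ : r * x < r * y); rewrite ltr_pM2l// => /(_ xy).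
rewrite !U_scale// -!mulrBr E1 powRN -!mulrA ler_pM2l// ler_pdivrMl// => h1.
by rewrite (le_trans h1)// mulrCA [r `^ alpha * _]mulrC.
Qed.

Let u_gt0 x : 0 < x -> 0 < u x.
Proof.
move=> x0; have rx : x < r * x by rewrite ltr_pMl.
have := le_right_slope U_concave x0 rx; rewrite U_scale//.
move=> h1; rewrite -(pmulr_rgt0 _ (_ : 0 < r * x - x)) ?subr_gt0//.
apply: lt_le_trans h1; rewrite -[X in _ - X]mul1r -mulrBl mulr_gt0 ?U_gt0//.
rewrite subr_gt0; have {1}-> : 1 = 1 `^ (1 - alpha) :> R by rewrite powR1.
by rewrite gt0_ltr_powR ?nnegrE ?ler01 ?(ltW r_gt0).
Qed.

Definition profile_p (x : R) : R := x `^ alpha * u x.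
Definition profile_q (x : R) : R := x `^ (alpha - 1) * U x.

Let qU x : 0 < x -> x `^ (1 - alpha) * profile_q x = U x.
Proof.
move=> x0; rewrite mulrA -powR_unitD// addrC subrKA subrr.
by rewrite powRr0 mul1r.
Qed.

Let q_per x : 0 < x -> profile_q (r * x) = profile_q x.
Proof.
move=> x0; rewrite /profile_q powRM ?(ltW r_gt0) ?(ltW x0)// mulrAC -U_scaleV//.
exact: mulrC.
Qed.

Let p_per x : 0 < x -> profile_p (r * x) = profile_p x.
Proof.
move=> x0; rewrite /profile_p u_scale// powRM ?(ltW r_gt0) ?(ltW x0)//.
rewrite mulrACA -powR_unitD// subrr powRr0 mul1r //.
Qed.

Let bounded_q : exists M, forall x, 0 < x -> profile_q x <= M.
Proof.
exists (U r) => x x0.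
have [y /andP[y1 yr] ->] := periodic_fundamental r_gt1 x0; last exact: q_per.
have y0 : 0 < y := lt_le_trans ltr01 y1.
rewrite (le_trans _ (U_nd y0 yr))// /profile_q ler_piMl ?(ltW (U_gt0 y0))//.
by rewrite -[leRHS](powRr0 y) ler_powR// subr_le0 ltW.
Qed.

(** Concavity and positivity give [(x / 2) u(x) <= U(x) - U(x / 2) <= U(x)], so [p] is at most
    [2 q]. *)
Let bounded_p : exists M, forall x, 0 < x -> profile_p x <= M.
Proof.
have [M hM] := bounded_q; exists (2 * M) => x x0.
have x20 : 0 < x / 2 by rewrite divr_gt0.
have x2x : x / 2 < x by rewrite ltr_pdivrMr// ltr_pMr// ltr1n.
have := ge_right_slope U_concave x20 x2x.
rewrite (_ : x - x / 2 = x / 2); last by field.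
move=> h1; have h2 : x * u x <= 2 * U x.
  have := U_gt0 x20; lra.
apply: le_trans (ler_wpM2l _ (hM x x0)); last by [].
rewrite /profile_q mulrCA /profile_p (_ : alpha = alpha - 1 + 1); last by rewrite subrK.
rewrite powR_unitD// powRr1 ?(ltW x0)// addrK -mulrA ler_wpM2l ?powR_ge0//.
Qed.

Let cvg_powR_right (a x : R) : 0 < x -> y `^ a @[y --> x^'+] --> x `^ a.
Proof.
move=> x0; apply: cvg_at_right_filter.
have /derivable1_diffP/differentiable_continuous : derivable (@powR R ^~ a) x 1.
  by apply: derivable_powR; rewrite in_itv/= x0.
exact.
Qed.

Let inf_image_gt0 (p : R -> R) (m : R) : 0 < m ->
  (forall x, 1 <= x <= r -> m <= p x) -> 0 < inf [set p x | x in `[1, r]].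
Proof.
move=> m0 hm; apply: lt_le_trans m0 _; apply: lb_le_inf.
  by exists (p 1), 1 => //=; rewrite in_itv/= lexx ltW.
by move=> _ /= [x /[!in_itv]/= xr <-]; exact: hm.
Qed.

Lemma profile_p_calP : calP r profile_p.
Proof.
split.
- by move=> x x0; rewrite mulr_gt0 ?powR_gt0 ?u_gt0.
- exact: bounded_p.
- move=> x x0; apply: cvgM; first exact: cvg_powR_right.
  exact: right_slope_right_continuous.
- apply: (@inf_image_gt0 _ (u r)); first exact: u_gt0.
  move=> x /andP[x1 xr]; have x0 : 0 < x := lt_le_trans ltr01 x1.
  have := right_slope_nincr U_concave x0 xr; move=> h1; apply: (le_trans h1).
  rewrite /profile_p ler_peMl ?(ltW (u_gt0 x0))//.
  by rewrite -[leLHS](powRr0 x) ler_powR// ltW.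
- by move=> x x0; rewrite mulrC p_per.
Qed.

Lemma profile_q_calP_rho : calP_rho r (1 - alpha) profile_q.
Proof.
split => //.
- split.
  + by move=> x x0; rewrite mulr_gt0 ?powR_gt0 ?U_gt0.
  + exact: bounded_q.
  + move=> x x0; apply: cvgM; first exact: cvg_powR_right.
    by apply: cvg_at_right_filter; exact: concave_continuous.
  + apply: (@inf_image_gt0 _ (r `^ (alpha - 1) * U 1)).
      by rewrite mulr_gt0 ?powR_gt0 ?U_gt0.
    move=> x /andP[x1 xr]; have x0 : 0 < x := lt_le_trans ltr01 x1.
    rewrite ler_pM ?powR_ge0 ?(ltW (U_gt0 _)) ?U_nd//.
    rewrite -opprB !powRN lef_pV2 ?posrE ?powR_gt0//.
    by rewrite ge0_ler_powR ?nnegrE ?(ltW rho_gt0) ?(ltW x0) ?(ltW r_gt0).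
  + by move=> x x0; rewrite mulrC q_per.
- by move=> x y x0 xy; rewrite !qU ?U_nd// (lt_le_trans x0).
Qed.

Lemma profile_opB : is_opB_inv r (1 - alpha) profile_q profile_p.
Proof.
split => //; first exact: profile_p_calP.
move=> x x0; rewrite /opB /profile_q opprB; congr (_ * _).
rewrite /Rintegral -[RHS]/(fine (U x)%:E).
rewrite -(integral_right_slope U_concave U_nd U_cvg0 x0).
congr fine; apply: eq_integral => y; rewrite inE/= in_itv/= => /andP[y0 _].
rewrite /profile_p mulrA -powR_unitD// (_ : _ - 1 + alpha = 0) ?powRr0 ?mul1r//.
by ring.
Qed.

(** After integration by parts, the powers cancel: [s^(1 - alpha) * s * (h(s) s^alpha / s^2) =
    h(s)]. *)
Lemma profile_opA : is_opA_inv r (1 - alpha) h profile_q.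
Proof.
split.
  split => //.
    apply: eq_completely_monotone (bernstein_div_id h_bernstein) => x x0.
    by rewrite /= opprB powR_unitD// powR_inv1 ?(ltW x0)//; ring.
  by move=> s s0; rewrite mulrC h_per.
exists profile_q_calP_rho => s s0; rewrite /opA /Rintegral.
have G0 : integrator profile_q_calP_rho 0 = 0 by rewrite /integrator ltxx.
rewrite (laplace_stieltjes s0 G0).
have -> : (\int[mu]_(y in `]0%R, +oo[)
      (expR (- (s * y)) * integrator profile_q_calP_rho y)%:E =
    (h s * s `^ alpha / s ^+ 2)%:E)%E.
  rewrite -U_laplace//; apply: eq_integral => y; rewrite inE/= in_itv/= andbT => y0.
  by rewrite /integrator y0 [profile_q y * _]mulrC qU.
rewrite -EFinM/= powR_unitD// powRr1 ?(ltW s0)// powRN.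
by field; rewrite !gt_eqF ?powR_gt0.
Qed.

Lemma opA_opB_inverses_exist :
  exists q p, is_opA_inv r (1 - alpha) h q /\ is_opB_inv r (1 - alpha) q p.
Proof.
by exists profile_q, profile_p; split; [exact: profile_opA|exact: profile_opB].
Qed.

(** * Identification of any admissible pair (q, p) with [U] *)

Section uniqueness.
Variables q p : R -> R.
Hypothesis hq : is_opA_inv r (1 - alpha) h q.
Hypothesis hp : is_opB_inv r (1 - alpha) q p.

Let Q (x : R) : R := q x * x `^ (1 - alpha).
Let v (y : R) : R := y `^ (1 - alpha - 1) * p y.

Let p_gt0 x : 0 < x -> 0 < p x. Proof. by have [_ [+ _ _ _ _] _] := hp; exact. Qed.
Let q_gt0 x : 0 < x -> 0 < q x.
Proof. by have [_ [[_ [+ _ _ _ _] _] _]] := hq; exact. Qed.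

Let QE x : 0 < x -> Q x = \int[mu]_(y in `]0, x]) v y.
Proof.
move=> x0; rewrite /Q; have [_ _ /(_ x x0) <-] := hp.
by rewrite /opB mulrAC -powR_unitD// addrC subrr powRr0 mul1r.
Qed.

Let v_ge0 y : 0 < y -> 0 <= v y.
Proof. by move=> y0; rewrite mulr_ge0 ?powR_ge0 ?(ltW (p_gt0 y0)). Qed.

Let measurable_v : measurable_fun (`]0, +oo[ : set R) v.
Proof.
apply: right_continuous_measurable => x x0; apply: cvgM; first exact: cvg_powR_right.
by have [_ [_ _ + _ _] _] := hp; exact.
Qed.

Let integrable_v x : 0 < x -> mu.-integrable `]0, x] (EFin \o v).
Proof.
move=> x0; apply/integrableP; split.
  apply/measurable_EFinP; apply: measurable_funS measurable_v => //.
  by move=> y /=; rewrite !in_itv/= andbT => /andP[].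
(* The real-valued integral is 0 by default when the extended one is infinite, so the positivity of
   [Q x] rules out divergence at 0. *)
have Q0 : 0 < Q x by rewrite mulr_gt0 ?q_gt0 ?powR_gt0.
rewrite (_ : \int[mu]_(y in `]0%R, x]) `|(EFin \o v) y|%E =
    \int[mu]_(y in `]0%R, x]) (v y)%:E)%E.
  move: Q0; rewrite QE// /Rintegral.
  have : (0 <= \int[mu]_(y in `]0%R, x]) (v y)%:E)%E.
    apply: integral_ge0 => y /=; rewrite in_itv/= => /andP[y0 _].
    by rewrite lee_fin v_ge0.
  case: (integral _ _ _) => [a| |]//= _; first by rewrite ltry.
  by rewrite [0 < 0]ltxx.
apply: eq_integral => y; rewrite inE/= in_itv/= => /andP[y0 _].
by rewrite /= ger0_norm ?v_ge0.
Qed.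

Let Q_continuous x : 0 < x -> {for x, continuous Q}.
Proof.
move=> x0; have x20 : 0 < x + 1 by rewrite addr_gt0.
have i1 : mu.-integrable `[0, x + 1] (EFin \o v).
  have := integrable_v x20 => /integrableP[mv iv].
  apply/integrableP; split.
    by apply/emeasurable_fun_itv_obnd_cbndP.
  by rewrite -integral_itv_obnd_cbnd//; apply: measurableT_comp.
have := parameterized_integral_continuous (ltW x20) i1.
move=> /continuous_within_itvP => /(_ x20)[+ _ _] => /(_ x).
rewrite in_itv/= x0 ltrDl ltr01 => /(_ isT) ci.
have e y : 0 < y -> Q y = parameterized_integral mu 0 y v.
  move=> y0; rewrite QE// /parameterized_integral Rintegral_itv_obnd_cbnd//.
  exact: integrable_v.
suff : Q y @[y --> x] --> Q x by [].
rewrite (e x x0); apply: cvg_trans ci.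
apply: near_eq_cvg; near=> y; rewrite e//.
by near: y; exact: lt_nbhsr.
Unshelve. all: by end_near. Qed.

Let QU x : 0 < x -> Q x = U x.
Proof.
have [C C0 UC] := U_le.
have [_ [hq' qE]] := hq.
have [_ [_ [M qM] _ _ _] _] := hq'.
apply: (@laplace_injective R Q U (C + `|M|)).
- exact: Q_continuous.
- by move=> y y0; exact: concave_continuous.
- move=> y y0; rewrite ger0_norm ?mulr_ge0 ?powR_ge0 ?(ltW (q_gt0 y0))//.
  have yr : y `^ (1 - alpha) <= 1 + y.
    have [y1|y1] := leP y 1.
      rewrite (@le_trans _ _ 1) ?lerDl ?(ltW y0)//.
      rewrite -[leRHS](powRr0 y) ger_powR ?y0//; exact: ltW.
    rewrite (@le_trans _ _ y) ?lerDr// ler1_powR ?(ltW y1)//.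
    by rewrite gerBl ltW.
  rewrite (@le_trans _ _ (`|M| * y `^ (1 - alpha)))//.
    by rewrite ler_wpM2r ?powR_ge0// (le_trans (qM y y0))// ler_norm.
  rewrite (le_trans (ler_wpM2l (normr_ge0 M) yr))// ler_wpM2r ?lerDr ?(ltW C0)//.
  by rewrite addr_ge0// ltW.
- move=> y y0; rewrite ger0_norm ?(ltW (U_gt0 y0))// (le_trans (UC y y0))//.
  by rewrite ler_wpM2r ?lerDl// addr_ge0// ltW.
- move=> s s0; rewrite U_laplace//.
  have := qE s s0; rewrite /opA /Rintegral.
  have G0 : integrator hq' 0 = 0 by rewrite /integrator ltxx.
  rewrite (laplace_stieltjes s0 G0).
  have -> : (\int[mu]_(y in `]0%R, +oo[) (expR (- (s * y)) * integrator hq' y)%:E =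
      \int[mu]_(y in `]0%R, +oo[) (expR (- (s * y)) * Q y)%:E)%E.
    apply: eq_integral => y; rewrite inE/= in_itv/= andbT => y0.
    by rewrite /integrator y0.
  have : (0 <= \int[mu]_(y in `]0%R, +oo[) (expR (- (s * y)) * Q y)%:E)%E.
    apply: integral_ge0 => y /=; rewrite in_itv/= andbT => y0.
    by rewrite lee_fin !mulr_ge0 ?expR_ge0 ?powR_ge0 ?(ltW (q_gt0 y0)).
  case: (integral _ _ _) => [a| |]//= _.
    move=> <-; congr EFin; rewrite powR_unitD// powRr1 ?(ltW s0)// powRN.
    by field; rewrite !gt_eqF ?powR_gt0.
  (* An infinite transform would be sent to 0 by [fine], contradicting [h s > 0]. *)
  rewrite gt0_muley ?lte_fin//= mulr0 => /esym/eqP.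
  by rewrite gt_eqF// h_gt0.
Qed.

(** [U] is the primitive of [y^(- alpha) p(y)], so its differentiability at continuity points of [p]
    is the fundamental theorem of calculus; this is where [z] in [C_p] enters. *)
Lemma is_derive_limit_mean (z : R) : 0 < z -> {for z, continuous p} ->
  is_derive z (1 : R) U (z `^ (- alpha) * p z).
Proof.
move=> z0 cp.
have z1 : 0 < z + 1 by rewrite addr_gt0.
have cv : {for z, continuous v}.
  apply: cvgM => //.
  have /derivable1_diffP/differentiable_continuous :
      derivable (@powR R ^~ (1 - alpha - 1)) z 1.
    by apply: derivable_powR; rewrite in_itv/= z0.
  exact.
have zz1 : z < z + 1 by rewrite ltrDl.
have bz : (BRight 0 < BRight z)%O by rewrite bnd_simp.
have [dF Fv] := continuous_FTC1 zz1 (integrable_v z1) bz cv.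
have FU : \forall y \near z,
    \int[mu]_(t in [set` Interval (BRight 0) (BRight y)]) v t = U y.
  near=> y; have y0 : 0 < y by near: y; exact: lt_nbhsr.
  by rewrite -QU// QE.
apply: DeriveDef; first exact: near_eq_derivable dF.
rewrite -(near_eq_derive _ FU) -derive1E Fv /v.
by rewrite addrAC subrr add0r.
Unshelve. all: by end_near. Qed.

End uniqueness.
End profile.

Theorem corollary2
  (R : realType)
  (d : measure_display) (Omega : measurableType d) (P : probability Omega R)
  (T : nat -> {RV P >-> R}) (T_ge0 : forall i w, 0 <= T i w)
  (alpha r : R)
  (* (i) *)
  (hi : (P [set w | forall i, T i w = 0%R \/ T i w = 1%R] < 1)%E)
  (* (ii) *)
  (hii : (1 < \int[P]_w positive_count T w)%E)
  (* (iii) *)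
  (alpha_gt0 : 0 < alpha) (alpha_le1 : alpha <= 1)
  (hiii1 : moment P T alpha = 1%E)
  (hiii2 : forall beta, 0 <= beta -> beta < alpha -> (1 < moment P T beta)%E)
  (* (iv) *)
  (hiv :
    [/\ (-oo < \int[P]_w \sum_(0 <= i <oo) (T i w `^ alpha * ln (T i w))%:E)%E,
        (\int[P]_w \sum_(0 <= i <oo) (T i w `^ alpha * ln (T i w))%:E < 0)%E
      & (\int[P]_w ((\sum_(0 <= i <oo) (T i w `^ alpha)%:E) *
                    log_plus (\sum_(0 <= i <oo) (T i w `^ alpha)%:E)) < +oo)%E]
    \/ (exists theta : R,
          [/\ 0 <= theta, theta < alpha & (moment P T theta < +oo)%E]))
  (* (v) *)
  (dW : measure_display) (OmegaW : measurableType dW)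
  (PW : probability OmegaW R) (W : {RV PW >-> R})
  (W_ge0 : forall w, 0 <= W w)
  (W_neq0 : (0 < PW [set w | W w != 0%R])%E)
  (hv : fixed_point_equation P (fun i w => T i w `^ alpha) W)
  (* (vi) *)
  (r_gt1 : 1 < r)
  (hvi1 : concentrated_on P T (rpowers r))
  (hvi2 : forall s : R, 1 < s -> concentrated_on P T (rpowers s) ->
            rpowers r `<=` rpowers s)
  (* the solution *)
  (dX : measure_display) (OmegaX : measurableType dX)
  (PX : probability OmegaX R) (X : {RV PX >-> R})
  (X_ge0 : forall w, 0 <= X w)
  (X_neq0 : (0 < PX [set w | X w != 0%R])%E)
  (X_fixed : fixed_point_equation P T X)
  (* the associated functions h and l; psi is the Laplace transform of W *)
  (h l : R -> R)
  (h_gt0 : forall t, 0 < t -> 0 < h t)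
  (h_per : forall t, 0 < t -> h (r * t) = h t)
  (h_bernstein : bernstein (fun t => h t * t `^ alpha))
  (X_laplace : forall t, 0 <= t -> laplace X t = laplace W (h t * t `^ alpha))
  (W_slow : slowly_varying 0^'+ (fun t => (1 - laplace W t) / t))
  (l_slow : slowly_varying +oo l)
  (l_def : forall t, 0 < t -> 1 - laplace W t = t * l t^-1) :
  (alpha < 1 ->
    (exists q p,
      is_opA_inv r (1 - alpha) h q /\ is_opB_inv r (1 - alpha) q p) /\
    (forall q p,
      is_opA_inv r (1 - alpha) h q -> is_opB_inv r (1 - alpha) q p ->
      forall z, 0 < z -> {for z, continuous p} ->
        (r ^+ n * z) `^ alpha / l (r `^ (alpha * n%:R)) *
          fine (PX [set w | r ^+ n * z < X w]) @[n --> \oo] --> p z)) /\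
  (alpha = 1 ->
    exists c : R, (forall t, 0 < t -> h t = c) /\
      (\int[distribution PX X]_(y in `[0, x]) y) / (c * l x)
        @[x --> +oo] --> (1 : R)).
Proof.
split.
- move=> alpha_lt1.
  have U_concave := limit_mean_concave X_ge0 alpha_gt0 r_gt1 h_gt0 h_per X_laplace
    l_slow l_def.
  have U_nd := limit_mean_nd X_ge0 alpha_gt0 r_gt1 h_gt0 h_per X_laplace
    l_slow l_def.
  have U_le := limit_mean_le X_ge0 alpha_gt0 r_gt1 h_gt0 h_per X_laplace
    l_slow l_def.
  have U_laplace := laplace_limit_mean X_ge0 alpha_gt0 r_gt1 h_gt0 h_per X_laplace
    l_slow l_def.
  have U_scale := limit_mean_scale X_ge0 alpha_gt0 r_gt1 h_gt0 h_per X_laplace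
    l_slow l_def.
  have U_gt0 := limit_mean_gt0 X_ge0 alpha_gt0 r_gt1 h_gt0 h_per X_laplace
    l_slow l_def.
  have U_cvg0 := limit_mean_cvg0 X_ge0 alpha_gt0 r_gt1 h_gt0 h_per X_laplace
    l_slow l_def alpha_lt1.
  split.
    exact: (opA_opB_inverses_exist alpha_gt0 alpha_lt1 r_gt1 h_gt0 h_per
      h_bernstein U_concave U_nd U_cvg0 U_gt0 U_scale U_laplace).
  move=> q p hq hp z z0 cp.
  have dU := is_derive_limit_mean alpha_gt0 alpha_lt1 h_gt0 U_concave U_gt0
    U_le U_laplace hq hp z0 cp.
  have := cvg_rescaled_tail X_ge0 alpha_gt0 r_gt1 h_gt0 h_per X_laplace
    l_slow l_def z0 dU.
  (* The factor [z^alpha] cancels [z^(- alpha)] in the derivative of [U] and completes [r^(alpha n)]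
     to [(r^n z)^alpha]. *)
  move=> /(cvgM (cvg_cst (z `^ alpha))).
  rewrite mulrA -powRD ?(gt_eqF z0) ?implybT// subrr powRr0 mul1r.
  suff -> : (fun n => (r ^+ n * z) `^ alpha / l (r `^ (alpha * n%:R)) *
      fine (PX [set w | r ^+ n * z < X w])) = (fun n => z `^ alpha *
      (scale_norm alpha r l n * fine (PX [set w | r ^+ n * z < X w]))) by [].
  apply/funext => n; have r0 : 0 < r := lt_trans ltr01 r_gt1.
  rewrite powRM ?exprn_ge0 ?(ltW r0) ?(ltW z0)// /scale_norm.
  have -> : r `^ (alpha * n%:R) = (r ^+ n) `^ alpha.
    by rewrite -powR_mulrn ?(ltW r0)// -powRrM mulrC.
  by ring.
- move=> alpha1.
  have h_cm : completely_monotone h.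
    apply: eq_completely_monotone (bernstein_div_id h_bernstein) => t t0.
    by rewrite alpha1 powRr1 ?(ltW t0)// mulfK// gt_eqF.
  have hE := periodic_nincr_constant r_gt1 h_per
    (fun x y => @completely_monotone_nincr R h x y h_cm).
  exists (h 1); split => //.
  have c0 : 0 < h 1 by exact: h_gt0.
  have l_gt0 x : 0 < x -> 0 < l x by case: l_slow => _ + _; exact.
  (* Needed for [a = 1] and [a = 2], the two scales compared in the truncated moment. The quotient
     is exactly [l(x / (h a)) / l(x)], with [h] constant. *)
  have key a : 0 < a ->
      x / a * (1 - laplace X (a / x)) / (h 1 * l x) @[x --> +oo] --> (1 : R).
    move=> a0; have [_ _ cl] := l_slow.
    have ha0 : 0 < (h 1 * a)^-1 by rewrite invr_gt0 mulr_gt0.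
    apply: cvg_trans (cl _ ha0); apply: near_eq_cvg; near=> x.
    have x0 : 0 < x by near: x; exact: nbhs_pinfty_gt.
    have ax0 : 0 < a / x by rewrite divr_gt0.
    have hax0 : 0 < h 1 * (a / x) by rewrite mulr_gt0.
    rewrite X_laplace ?(ltW ax0)// hE// alpha1 powRr1 ?(ltW ax0)// l_def//.
    have -> : (h 1 * (a / x))^-1 = (h 1 * a)^-1 * x.
      by field; rewrite !gt_eqF.
    have := l_gt0 x x0 => lx0.
    by field; rewrite !gt_eqF.
  have key1 : x * (1 - laplace X x^-1) / (h 1 * l x) @[x --> +oo] --> (1 : R).
    suff -> : (fun x => x * (1 - laplace X x^-1) / (h 1 * l x)) =
        (fun x => x / 1 * (1 - laplace X (1 / x)) / (h 1 * l x)) by exact: key.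
    by apply/funext => x; rewrite divr1 mul1r.
  apply: (@cvg_truncated_first_moment _ _ R PX X X_ge0 (fun x => h 1 * l x)).
  + by move=> x x0; rewrite mulr_gt0// l_gt0.
  + exact: key1.
  + exact: key.
Unshelve. all: by end_near. Qed.
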